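(* Assume that $\mathbb{E}[\|N\|_2^2+\|\Lambda^{\mathsf T}\Lambda\|_2^2]<\infty$ and that $\mathbb{E}[N]$ is positive definite. Let $(Q_t)_{t\ge 0}$ be the Q-learning sequence $$Q_{t+1}=Q_t+\alpha_t\big(N_{t+1}+\Lambda_{t+1}^{\mathsf T}\Pi(Q_t)\Lambda_{t+1}-Q_t\big),\quad t=0,1,2,\dots,$$ with initial matrix $Q_0\in\mathbb{S}_+^d$. Then the following statements are equivalent: (a) the LQ problem is well-posed, i.e. $V(x)<\infty$ for all $x\in\mathbb{R}^n$; (b) the algebraic Riccati equation $K=\Pi(\mathbb{E}[N+\Lambda^{\mathsf T}K\Lambda])$ admits a solution $K$; (c) $(Q_t)_{t\ge0}$ is bounded with positive probability, i.e. $\mathbb{P}(\sup_t\|Q_t\|_2<\infty)>0$; (d) $(Q_t)_{t\ge0}$ converges almost surely to a deterministic matrix $Q^\star\in\mathbb{S}_+^d$. Moreover, if any one of these statements is valid, then: (1) the value function is $V(x)=x^{\mathsf T}Kx$ for all $x\in\mathbb{R}^n$; (2) the solution of the algebraic Riccati equation is unique and given by $K=\Pi(Q^\star)$; (3) the optimal control is given in feedback form by $u_t^\star=\Gamma(Q^\star)x_t$, i.e. for every initial state $x$ this control satisfies $\mathbb{E}[J(x,u^\star_\cdot)]=V(x)$; (4) $Q^\star=\mathbb{E}[N+\Lambda^{\mathsf T}\Pi(Q^\star)\Lambda]$.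
   Context: Let $n,m\ge1$ be integers and $d=n+m$. $\mathbb{S}_+^k$ is the set of real symmetric positive semidefinite $k\times k$ matrices, and $\|\cdot\|_2$ is the matrix $2$-norm. For $P\in\mathbb{S}_+^d$ write $P=\begin{bmatrix} P_{xx} & P_{xu} \\ P_{ux} & P_{uu} \end{bmatrix}$ with $P_{xx}\in\mathbb{R}^{n\times n}$, and define $$\Pi(P)=P_{xx}-P_{xu}P_{uu}^{+}P_{ux},\qquad \Gamma(P)=-P_{uu}^{+}P_{ux},$$ where $P_{uu}^+$ is the Moore--Penrose pseudoinverse. On a probability space $(\Omega,\mathcal F,\mathbb P)$ let $(\Lambda_t,N_t)$, $t=1,2,\dots$, be independent and identically distributed random pairs with $\Lambda_t\in\mathbb{R}^{n\times d}$ and $N_t\in\mathbb{S}_+^d$; $(\Lambda,N)$ denotes an independent copy of $(\Lambda_1,N_1)$. Let $\mathcal F_0=\{\varnothing,\Omega\}$ and $\mathcal F_t=\sigma\{\Lambda_s,N_s:s=1,\dots,t\}$. Given an initial state $x_0=x\in\mathbb{R}^n$ and an admissible control, i.e. any $(\mathcal F_t)$-adapted $\mathbb{R}^m$-valued process $u_\cdot=(u_t)_{t\ge0}$, the state evolves by $x_{t+1}=\Lambda_{t+1}\begin{bmatrix} x_t \\ u_t \end{bmatrix}$, and the cost is $J(x,u_\cdot)=\sum_{t=0}^\infty [x_t^{\mathsf T},u_t^{\mathsf T}]N_{t+1}\begin{bmatrix} x_t \\ u_t \end{bmatrix}\in[0,\infty]$. The value function is $V(x)=\inf_{u_\cdot}\mathbb{E}[J(x,u_\cdot)]$,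 the infimum being over admissible controls. A solution of the algebraic Riccati equation $K=\Pi(\mathbb{E}[N+\Lambda^{\mathsf T}K\Lambda])$ means a matrix $K\in\mathbb{S}_+^n$ satisfying it. The learning rates $\alpha_t\in[0,1]$, $t=0,1,\dots$, may be random, with $\alpha_t$ being $\mathcal F_t$-measurable, and satisfy $\sum_{t}\alpha_t=\infty$ and $\sum_t\alpha_t^2<\infty$ (almost surely). The initial matrix $Q_0$ is deterministic. *)

(* Defs.v *)
From HB Require Import structures.
From mathcomp Require Import all_boot all_order all_algebra.
From mathcomp Require Import all_classical all_reals all_analysis.

Set Implicit Arguments.
Unset Strict Implicit.
Unset Printing Implicit Defensive.

Import Order.TTheory GRing.Theory Num.Theory.
Import numFieldNormedType.Exports.

Local Open Scope classical_set_scope.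
Local Open Scope ring_scope.

Section Matrices.
Context {R : realType}.

Definition qform k (A : 'M[R]_k) (v : 'cV[R]_k) : R := (v^T *m A *m v) 0 0.

Definition psd k (A : 'M[R]_k) : Prop :=
  A^T = A /\ forall v : 'cV[R]_k, 0 <= qform A v.

Definition posdef k (A : 'M[R]_k) : Prop :=
  A^T = A /\ forall v : 'cV[R]_k, v != 0 -> 0 < qform A v.

Definition enorm k (v : 'cV[R]_k) : R := Num.sqrt (\sum_i v i 0 ^+ 2).

(* The library norm `|A| on matrices is the max norm, hence this definition. *)
Definition norm2 p q (A : 'M[R]_(p, q)) : R :=
  sup [set enorm (A *m v) | v in [set v : 'cV[R]_q | enorm v <= 1]].

Definition penrose p q (A : 'M[R]_(p, q)) (X : 'M[R]_(q, p)) : Prop :=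
  [/\ A *m X *m A = A, X *m A *m X = X,
      (A *m X)^T = A *m X & (X *m A)^T = X *m A].

(* The default value 0 is never used: see mpinvP. *)
Definition mpinv p q (A : 'M[R]_(p, q)) : 'M[R]_(q, p) :=
  xget 0 [set X | penrose A X].

Lemma row_free_gram_unit r q (B : 'M[R]_(r, q)) :
  row_free B -> B *m B^T \in unitmx.
Proof.
move=> fB; rewrite -row_free_unit -kermx_eq0; apply/eqP/row_matrixP => i.
rewrite row0; set v := row i _.
have vBB : v *m (B *m B^T) = 0 by rewrite -row_mul mulmx_ker row0.
have sq0 : \sum_j (v *m B) 0 j ^+ 2 = 0.
  have : ((v *m B) *m (v *m B)^T) 0 0 = 0.
    by rewrite trmx_mul mulmxA -(mulmxA v) vBB mul0mx mxE.
  rewrite mxE => h; rewrite -[RHS]h.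
  by apply: eq_bigr => j _; rewrite [(v *m B)^T _ _]mxE expr2.
have vB : v *m B = 0.
  apply/matrixP => a j; rewrite ord1 [RHS]mxE; apply/eqP.
  rewrite -sqrf_eq0; apply/eqP.
  by apply: (psumr_eq0P _ sq0) => // k _; exact: sqr_ge0.
by apply: (row_free_inj fB); rewrite mul0mx.
Qed.

Lemma penrose_exists p q (A : 'M[R]_(p, q)) : exists X, penrose A X.
Proof.
have [r [C [F [-> fC fF]]]] :
    exists r (C : 'M[R]_(p, r)) (F : 'M[R]_(r, q)),
    [/\ A = C *m F, row_free C^T & row_free F].
  exists (\rank A), (col_base A), (row_base A); split.
  - by rewrite mulmx_base.
  - by rewrite /row_free mxrank_tr; have := col_base_full A.
  - exact: row_base_free.
have uF := row_free_gram_unit fF.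
have uC := row_free_gram_unit fC; rewrite trmxK in uC.
pose W := F^T *m invmx (F *m F^T); pose L := invmx (C^T *m C) *m C^T.
have FW : F *m W = 1%:M by rewrite mulmxA mulmxV.
have LC : L *m C = 1%:M by rewrite -mulmxA mulVmx.
have AX : C *m F *m (W *m L) = C *m L by rewrite -mulmxA (mulmxA F) FW mul1mx.
have XA : W *m L *m (C *m F) = W *m F by rewrite -mulmxA (mulmxA L) LC mul1mx.
exists (W *m L); split.
- by rewrite AX -mulmxA (mulmxA L) LC mul1mx.
- by rewrite XA -mulmxA (mulmxA F) FW mul1mx.
- by rewrite AX /L !trmx_mul trmx_inv trmx_mul trmxK mulmxA.
- by rewrite XA /W !trmx_mul trmx_inv trmx_mul trmxK mulmxA.
Qed.

Lemma penrose_unique p q (A : 'M[R]_(p, q)) X Y :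
  penrose A X -> penrose A Y -> X = Y.
Proof.
move=> [x1 x2 x3 x4] [y1 y2 y3 y4].
have AXY : A *m X = A *m Y.
  by rewrite -x3 -{1}y1 -mulmxA trmx_mul x3 y3 mulmxA x1.
have XAY : X *m A = Y *m A.
  by rewrite -x4 -{1}y1 -(mulmxA A) mulmxA trmx_mul x4 y4 -mulmxA (mulmxA A) x1.
by rewrite -x2 -mulmxA AXY mulmxA XAY y2.
Qed.

Lemma mpinvP p q (A : 'M[R]_(p, q)) : penrose A (mpinv A).
Proof. by have [X AX] := penrose_exists A; exact: (xgetI _ AX). Qed.

Definition Pi n m (P : 'M[R]_(n + m)) : 'M[R]_n :=
  ulsubmx P - ursubmx P *m mpinv (drsubmx P) *m dlsubmx P.

Definition Gamma n m (P : 'M[R]_(n + m)) : 'M[R]_(m, n) :=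
  - (mpinv (drsubmx P) *m dlsubmx P).

End Matrices.

(* Matrices with the Borel sigma-algebra, generated by the entries. *)
Definition entry_cylinders (R : realType) p q : set (set 'M[R]_(p, q)) :=
  [set A | exists i j (B : set R),
     measurable B /\ A = [set M : 'M[R]_(p, q) | B (M i j)]].

Definition mxborel (R : realType) p q : Type :=
  g_sigma_algebraType (@entry_cylinders R p q).

Section Probability.
Context {R : realType}.

Definition same_law d d' e (T : measurableType d) (T' : measurableType d')
    (S : measurableType e) (P : probability T R) (P' : probability T' R)
    (X : T -> S) (X' : T' -> S) : Prop :=
  forall B, measurable B -> P (X @^-1` B) = P' (X' @^-1` B).

Definition independent_seq d e (T : measurableType d) (S : measurableType e)
    (P : probability T R) (X : nat -> T -> S) : Prop :=
  forall (I : seq nat) (B : nat -> set S), uniq I ->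
    (forall t, measurable (B t)) ->
    P (\bigcap_(t in [set` I]) X t @^-1` B t) =
    (\prod_(t <- I) P (X t @^-1` B t))%E.

Definition iid d e (T : measurableType d) (S : measurableType e)
    (P : probability T R) (X : nat -> T -> S) : Prop :=
  [/\ forall t, measurable_fun setT (X t), independent_seq P X
    & forall t, same_law P P (X t) (X 0%N)].

Definition adapted d e (T : measurableType d) (S : measurableType e)
    (F : nat -> set (set T)) (X : nat -> T -> S) : Prop :=
  forall t B, measurable B -> F t (X t @^-1` B).

Definition mxexp d (T : measurableType d) (P : probability T R) p q
    (X : T -> 'M[R]_(p, q)) : 'M[R]_(p, q) :=
  \matrix_(i, j) \int[P]_w X w i j.

Definition as_pair d (T : measurableType d) p q r s
    (X : T -> 'M[R]_(p, q)) (Y : T -> 'M[R]_(r, s)) :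
    T -> mxborel R p q * mxborel R r s :=
  fun w => (X w, Y w).

End Probability.

(* Lam t and N t stand for Lambda_t and N_t for t >= 1; Lam 0 and N 0 are
   never used. *)
Section LQ.
Context {R : realType} {d : measure_display} {T : measurableType d}.
Variables (P : probability T R) (n m : nat).
Variables (Lam : nat -> T -> 'M[R]_(n, n + m)) (N : nat -> T -> 'M[R]_(n + m)).

Definition filtration (t : nat) : set (set T) :=
  <<s \bigcup_(s in [set s | (1 <= s <= t)%N])
        preimage_set_system setT (as_pair (Lam s) (N s)) measurable >>.

Definition admissible (u : nat -> T -> 'cV[R]_m) : Prop :=
  adapted filtration (u : nat -> T -> mxborel R m 1).

Fixpoint state (x : 'cV[R]_n) (u : nat -> T -> 'cV[R]_m) (t : nat) (w : T) :
    'cV[R]_n :=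
  if t is s.+1 then Lam s.+1 w *m col_mx (state x u s w) (u s w) else x.

Definition cost (x : 'cV[R]_n) (u : nat -> T -> 'cV[R]_m) (w : T) : \bar R :=
  (\sum_(0 <= t <oo)
     (qform (N t.+1 w) (col_mx (state x u t w) (u t w)))%:E)%E.

Definition value (x : 'cV[R]_n) : \bar R :=
  ereal_inf [set (\int[P]_w cost x u w)%E | u in admissible].

Fixpoint Qseq (alpha : nat -> T -> R) (Q0 : 'M[R]_(n + m)) (t : nat) (w : T) :
    'M[R]_(n + m) :=
  if t is s.+1 then
    let Q := Qseq alpha Q0 s w in
    Q + alpha s w *: (N s.+1 w + (Lam s.+1 w)^T *m Pi Q *m Lam s.+1 w - Q)
  else Q0.

End LQ.

(* E[M + L^T K L] for a random pair (L, M) with the law of (Lambda, N). *)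
Definition Ebackup (R : realType) d (T : measurableType d)
    (P : probability T R) n m (L : T -> 'M[R]_(n, n + m))
    (M : T -> 'M[R]_(n + m)) (K : 'M[R]_n) : 'M[R]_(n + m) :=
  mxexp P (fun w => M w + (L w)^T *m K *m L w).

Definition ARE_solution (R : realType) d (T : measurableType d)
    (P : probability T R) n m (L : T -> 'M[R]_(n, n + m))
    (M : T -> 'M[R]_(n + m)) (K : 'M[R]_n) : Prop :=
  psd K /\ K = Pi (Ebackup P L M K).

(* Main.v *)
(** Write [F K = E[N + Lambda^T K Lambda]] and let [<=] be the order of quadratic
    forms. [Pi] is monotone and positively homogeneous, since
    [x^T Pi(P) x = min_u [x;u]^T P [x;u]] for semidefinite [P].

    Value iteration [K_0 = 0], [K_{k+1} = Pi (F K_k)] increases and lies below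
    the cost of every control, hence below every Riccati solution. If it is
    bounded, its limit solves the Riccati equation; as [E[N]] is definite, [F o Pi]
    contracts towards [W = F K] in the gauge [inf {s : P <= s W}], so that the
    solution is unique. Feedback by [Gamma (F K)] costs at most [x^T K x].

    For the iterates, a martingale argument (a maximal inequality obtained by
    freezing the sum when it crosses a level) shows that averages of centred noise
    with bounded predictable coefficients tend to 0 almost surely. Comparison
    with such averages gives, on almost every path and without any assumption,
    [Q_t >= (1 - e) F K_k] eventually for all [k] and [e]: boundedness of [Q_t] on
    an event of positive probability therefore bounds [K_k]. If a solution [K]
    exists, the noise normalised by a running scale of [Q_t] still averages to 0,
    and the contraction keeps [Q_t] below a multiple of [W]; repeating the
    comparison brings that multiple down to 1, so that [Q_t] converges to [W]. *)

Require Import Defs.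
From mathcomp Require Import all_boot all_order all_algebra.
From mathcomp Require Import all_classical all_reals all_analysis.
From mathcomp Require Import measurable_realfun ring lra.

Set Implicit Arguments.
Unset Strict Implicit.
Unset Printing Implicit Defensive.

Import Order.TTheory GRing.Theory Num.Theory.
Import numFieldNormedType.Exports.

Local Open Scope classical_set_scope.
Local Open Scope ring_scope.

(** * Quadratic forms and the Schur complement *)

Section QuadraticForms.
Context {R : realType}.

(** The contraction has its source in affinity: [F (s *: K) = s *: F K + (1 - s) *: E0] with [E0 =
    E[N]]. If [d *: F K <= E0] and [s >= 1], the last term removes at least the share [d] of the
    excess [s - 1]. Affinity, monotonicity and preservation of semidefiniteness are all that the
    deterministic part assumes of [F]. The pseudoinverse is not continuous, so no limit is passed
    through [Pi]: bounds by [1 - e] and [1 + e] times a definite matrix, together with homogeneity,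
    take the place of continuity. The upper bound on the iterates faces a circle: the noise entering
    [Q_{t+1}] has coefficients [Pi(Q_t)], its averages are under control only for bounded
    coefficients, and boundedness of [Q_t] is the goal. Dividing by a scale that stays constant
    between resets breaks the circle. Once the normalised averages are small, the contraction
    outweighs them and at most one more reset occurs; from then on the scale is a constant and the
    noise itself averages to 0. *)

Definition mle k (A B : 'M[R]_k) : Prop := forall v, qform A v <= qform B v.

Definition bform k (A : 'M[R]_k) (v w : 'cV[R]_k) : R := (v^T *m A *m w) 0 0.

Lemma bformDl k (A : 'M[R]_k) u v w : bform A (u + v) w = bform A u w + bform A v w.
Proof. by rewrite /bform linearD /= !mulmxDl mxE. Qed.

Lemma bformDr k (A : 'M[R]_k) u v w : bform A w (u + v) = bform A w u + bform A w v.
Proof. by rewrite /bform mulmxDr mxE. Qed.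

Lemma bformZl k (A : 'M[R]_k) c v w : bform A (c *: v) w = c * bform A v w.
Proof. by rewrite /bform linearZ /= -!scalemxAl mxE. Qed.

Lemma bformZr k (A : 'M[R]_k) c v w : bform A v (c *: w) = c * bform A v w.
Proof. by rewrite /bform -scalemxAr mxE. Qed.

Lemma bformC k (A : 'M[R]_k) v w : A^T = A -> bform A v w = bform A w v.
Proof.
move=> sA; rewrite /bform -[in LHS](trmxK (v^T *m A *m w)) [LHS]mxE.
by rewrite !trmx_mul trmxK sA mulmxA.
Qed.

Lemma qformDv k (A : 'M[R]_k) v w : A^T = A ->
  qform A (v + w) = qform A v + 2 * bform A v w + qform A w.
Proof.
move=> sA; rewrite -[qform A (v + w)]/(bform A _ _) bformDl !bformDr.
rewrite (bformC w v sA) -[bform A v v]/(qform A v) -[bform A w w]/(qform A w).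
by ring.
Qed.

Lemma qformZv k (A : 'M[R]_k) c v : qform A (c *: v) = c ^+ 2 * qform A v.
Proof. by rewrite -[LHS]/(bform A _ _) bformZl bformZr mulrA expr2. Qed.

Lemma qformD k (A B : 'M[R]_k) v : qform (A + B) v = qform A v + qform B v.
Proof. by rewrite /qform mulmxDr mulmxDl mxE. Qed.

Lemma qformZ k (A : 'M[R]_k) c v : qform (c *: A) v = c * qform A v.
Proof. by rewrite /qform -scalemxAr -scalemxAl mxE. Qed.

Lemma qformN k (A : 'M[R]_k) v : qform (- A) v = - qform A v.
Proof. by rewrite -scaleN1r qformZ mulN1r. Qed.

Lemma qformB k (A B : 'M[R]_k) v : qform (A - B) v = qform A v - qform B v.
Proof. by rewrite qformD qformN. Qed.

Lemma qform0 k (v : 'cV[R]_k) : qform 0 v = 0.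
Proof. by rewrite /qform mulmx0 mul0mx mxE. Qed.

Lemma qform0v k (A : 'M[R]_k) : qform A 0 = 0.
Proof. by rewrite /qform mulmx0 mxE. Qed.

Lemma qform_conj k l (A : 'M[R]_k) (B : 'M[R]_(k, l)) v :
  qform (B^T *m A *m B) v = qform A (B *m v).
Proof. by rewrite /qform trmx_mul !mulmxA. Qed.

Lemma qformE k (A : 'M[R]_k) v :
  qform A v = \sum_i \sum_j A i j * (v i 0 * v j 0).
Proof.
rewrite /qform mxE exchange_big /=; apply: eq_bigr => j _.
rewrite mxE mulr_suml; apply: eq_bigr => i _.
by rewrite mxE mulrA [v i 0 * _]mulrC.
Qed.

Lemma bform_delta k (A : 'M[R]_k) i j :
  bform A (delta_mx i 0) (delta_mx j 0) = A i j.
Proof.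
by rewrite /bform trmx_delta -rowE -colE !mxE.
Qed.

Lemma mle_refl k (A : 'M[R]_k) : mle A A.
Proof. by move=> v. Qed.

Lemma mle_trans k (B A C : 'M[R]_k) : mle A B -> mle B C -> mle A C.
Proof. by move=> AB BC v; exact: le_trans (AB v) (BC v). Qed.

Lemma psd0 k : psd (0 : 'M[R]_k).
Proof. by split=> [|v]; rewrite ?trmx0 ?qform0. Qed.

Lemma psdD k (A B : 'M[R]_k) : psd A -> psd B -> psd (A + B).
Proof.
move=> [sA pA] [sB pB]; split=> [|v]; first by rewrite linearD /= sA sB.
by rewrite qformD addr_ge0.
Qed.

Lemma psdZ k (A : 'M[R]_k) c : 0 <= c -> psd A -> psd (c *: A).
Proof.
move=> c0 [sA pA]; split=> [|v]; first by rewrite linearZ /= sA.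
by rewrite qformZ mulr_ge0.
Qed.

Lemma psd_conj k l (A : 'M[R]_k) (B : 'M[R]_(k, l)) :
  psd A -> psd (B^T *m A *m B).
Proof.
move=> [sA pA]; split=> [|v]; last by rewrite qform_conj.
by rewrite !trmx_mul trmxK sA mulmxA.
Qed.

Lemma posdef_psd k (A : 'M[R]_k) : posdef A -> psd A.
Proof.
move=> [sA pA]; split=> // v; have [->|v0] := eqVneq v 0; first by rewrite qform0v.
exact/ltW/pA.
Qed.

Lemma posdef_le k (A B : 'M[R]_k) : B^T = B -> posdef A -> mle A B -> posdef B.
Proof.
by move=> sB [sA pA] AB; split=> // v v0; exact: lt_le_trans (pA v v0) (AB v).
Qed.

(** The degenerate case [c = 0] matters: there it forces [b = 0], which is how [psd_range] uses
    it. *)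
Lemma quadratic_ge0_discr (a b c : R) : 0 <= c ->
  (forall t, 0 <= a + 2 * t * b + t ^+ 2 * c) -> b ^+ 2 <= a * c.
Proof.
rewrite le_eqVlt => /predU1P[<-|c0] h.
  have [->|b0] := eqVneq b 0; first by rewrite mulr0 expr0n.
  have := h (- (a + 1) / (2 * b)); rewrite mulr0 addr0.
  have -> : a + 2 * (- (a + 1) / (2 * b)) * b = - 1 by field.
  by rewrite ler0N1.
have cn0 : c != 0 by rewrite gt_eqF.
have := h (- b / c); have -> : a + 2 * (- b / c) * b + (- b / c) ^+ 2 * c =
  (a * c - b ^+ 2) / c by field.
by rewrite pmulr_lge0 ?invr_gt0// subr_ge0.
Qed.

Lemma psd_cauchy k (A : 'M[R]_k) v w : psd A ->
  bform A v w ^+ 2 <= qform A v * qform A w.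
Proof.
move=> [sA pA]; apply: quadratic_ge0_discr => // t.
have := pA (v + t *: w); rewrite qformDv// bformZr qformZv.
by rewrite [2 * (t * _)]mulrA.
Qed.

Lemma posdef_unit k (W : 'M[R]_k) : posdef W -> W \in unitmx.
Proof.
move=> [sW pW]; rewrite -row_free_unit -kermx_eq0; apply/eqP/row_matrixP => i.
rewrite row0; set v := row i _.
have vW : v *m W = 0 by rewrite -row_mul mulmx_ker row0.
have [//|v0] := eqVneq v 0.
have : 0 < qform W v^T by apply: pW; rewrite -(inj_eq trmx_inj) trmxK trmx0.
by rewrite /qform trmxK vW mul0mx mxE ltxx.
Qed.

(** The coordinate [v i 0] is the [W]-inner product of [invmx W *m delta_mx i 0] with [v], and that
    vector has squared [W]-norm [invmx W i i]; Cauchy-Schwarz concludes. *)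
Lemma posdef_coord k (W : 'M[R]_k) (v : 'cV_k) i : posdef W ->
  v i 0 ^+ 2 <= invmx W i i * qform W v.
Proof.
move=> pW; have uW := posdef_unit pW; have sW := pW.1.
have -> : v i 0 = bform W (invmx W *m delta_mx i 0) v.
  rewrite /bform trmx_mul trmx_inv sW -[_ *m W]mulmxA mulVmx// mulmx1.
  by rewrite trmx_delta -rowE mxE.
have -> : invmx W i i = qform W (invmx W *m delta_mx i 0).
  rewrite /qform trmx_mul trmx_inv sW -[_ *m W]mulmxA mulVmx// mulmx1.
  by rewrite trmx_delta mulmxA -rowE -colE !mxE.
exact/psd_cauchy/posdef_psd.
Qed.

Definition entry_sum k (A : 'M[R]_k) : R := \sum_i \sum_j `|A i j|.

Lemma entry_sum_ge0 k (A : 'M[R]_k) : 0 <= entry_sum A.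
Proof. by apply: sumr_ge0 => i _; apply: sumr_ge0. Qed.

(** A definite matrix is an order unit: every square [v i 0 ^+ 2], hence every product
    [v i 0 * v j 0], is at most a fixed multiple of [qform W v]. As [A] is arbitrary, noise of
    either sign is covered. *)
Lemma posdef_dominates k (W : 'M[R]_k) : posdef W ->
  exists2 C, 0 <= C & forall A, mle A ((C * entry_sum A) *: W).
Proof.
move=> pW; pose C := \sum_i `|invmx W i i|.
exists C => [|A v]; first exact: sumr_ge0.
have q0 := (posdef_psd pW).2 v.
have vi i : v i 0 ^+ 2 <= C * qform W v.
  apply: le_trans (posdef_coord v i pW) _; rewrite ler_wpM2r//.
  by rewrite /C (bigD1 i)//= ler_wpDr ?sumr_ge0// ler_norm.
rewrite qformZ [C * _]mulrC -mulrA qformE /entry_sum mulr_suml.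
apply: ler_sum => i _; rewrite mulr_suml; apply: ler_sum => j _.
apply: le_trans (ler_norm _) _; rewrite normrM ler_wpM2l//.
rewrite ler_norml; have := vi i; have := vi j.
have := sqr_ge0 (v i 0 - v j 0); have := sqr_ge0 (v i 0 + v j 0).
by rewrite sqrrD sqrrB !mulr2n => *; apply/andP; split; lra.
Qed.

Lemma posdef_rate k (E W : 'M[R]_k) : posdef E ->
  exists2 d, 0 < d < 1 & mle (d *: W) E.
Proof.
move=> pE; have [C C0 CE] := posdef_dominates pE.
have c0 : 0 <= C * entry_sum W by rewrite mulr_ge0 ?entry_sum_ge0.
(* Adding 2 keeps the inverse strictly between 0 and 1 even if [C * entry_sum W] vanishes. *)
exists (C * entry_sum W + 2)^-1.
  by apply/andP; split; [rewrite invr_gt0|rewrite invf_lt1]; lra.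
move=> v; rewrite qformZ ler_pdivrMl; last by lra.
apply: le_trans (CE _ v) _; rewrite qformZ ler_wpM2r//; last by lra.
exact: (posdef_psd pE).2.
Qed.

Lemma polarization k (A : 'M[R]_k) i j : A^T = A ->
  4 * A i j = qform A (delta_mx i 0 + delta_mx j 0) -
              qform A (delta_mx i 0 - delta_mx j 0).
Proof.
move=> sA; rewrite -[- delta_mx j 0]scaleN1r !qformDv// bformZr qformZv bform_delta.
by ring.
Qed.

(** Polarization bounds [4 * A i j] by two values of [qform B], whose sum is [2 * (B i i + B j j)]
    by the parallelogram law. Bounds in the order thus control entries. *)
Lemma entry_le k (A B : 'M[R]_k) i j : A^T = A ->
  (forall v, `|qform A v| <= qform B v) -> `|A i j| <= B i i + B j j.
Proof.
move=> sA AB; have := polarization i j sA.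
have := AB (delta_mx i 0 + delta_mx j 0); have := AB (delta_mx i 0 - delta_mx j 0).
have : qform B (delta_mx i 0 + delta_mx j 0) + qform B (delta_mx i 0 - delta_mx j 0)
   = 2 * (B i i + B j j).
  rewrite -[- delta_mx j 0]scaleN1r.
  have qb v : qform B v = bform B v v by [].
  rewrite !qb !bformDl !bformDr !bformZl !bformZr !bform_delta; ring.
have : 0 <= B i i + B j j.
  apply: addr_ge0; rewrite -bform_delta; exact: le_trans (normr_ge0 _) (AB _).
rewrite !ler_norml => ? ? /andP[? ?] /andP[? ?] ?; apply/andP; split; lra.
Qed.

Lemma psd_entry_le k (A B : 'M[R]_k) i j : psd A -> mle A B ->
  `|A i j| <= B i i + B j j.
Proof.
by move=> [sA pA] AB; apply: entry_le => // v; rewrite ger0_norm.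
Qed.

Lemma mle_antisym k (A B : 'M[R]_k) : A^T = A -> B^T = B ->
  mle A B -> mle B A -> A = B.
Proof.
move=> sA sB AB BA; apply/matrixP => i j.
have qAB v : qform A v = qform B v by apply/eqP; rewrite eq_le AB BA.
have := polarization i j sA; rewrite !qAB -polarization//; lra.
Qed.

End QuadraticForms.

(** * The Schur complement as a minimum over the control *)

Section SchurComplement.
Context {R : realType}.

Lemma mpinv_sym k (A : 'M[R]_k) : A^T = A -> (mpinv A)^T = mpinv A.
Proof.
move=> sA; apply: (@penrose_unique _ _ _ A) (mpinvP A).
have [x1 x2 x3 x4] := mpinvP A; split.
- by apply: trmx_inj; rewrite !trmx_mul trmxK sA mulmxA.
- by apply: trmx_inj; rewrite !trmx_mul !trmxK sA mulmxA.
- by rewrite trmx_mul trmxK sA -x4 trmx_mul sA.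
- by rewrite trmx_mul trmxK sA -x3 trmx_mul sA.
Qed.

Variables n m : nat.
Implicit Types P : 'M[R]_(n + m).

Lemma sym_dlsubmx P : P^T = P -> (dlsubmx P)^T = ursubmx P.
Proof. by move=> sP; rewrite trmx_dlsub sP. Qed.

Lemma qform_block P x u : P^T = P ->
  qform P (col_mx x u) = qform (ulsubmx P) x +
    2 * (u^T *m dlsubmx P *m x) 0 0 + qform (drsubmx P) u.
Proof.
move=> sP; rewrite /qform tr_col_mx -[in LHS](submxK P) mul_row_block.
rewrite mul_row_col !mulmxDl.
have -> : x^T *m ursubmx P *m u = (u^T *m dlsubmx P *m x)^T.
  by rewrite !trmx_mul trmxK sym_dlsubmx// mulmxA.
rewrite !mxE; ring.
Qed.

Lemma psd_drsubmx P : psd P -> psd (drsubmx P).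
Proof.
move=> [sP pP]; split=> [|u]; first by rewrite trmx_drsub sP.
have := pP (col_mx 0 u); rewrite qform_block// qform0v mulmx0 mxE.
by rewrite mulr0 !add0r.
Qed.

(** The range of [P_ux] lies in that of [P_uu]. With [E] the orthogonal projector onto the kernel of
    [P_uu], the form at [(e_j, t E e_i)] is affine in [t] with slope [2 (E P_ux)_ij]; nonnegativity
    for all [t] makes the slope zero. *)
Lemma psd_range P : psd P ->
  drsubmx P *m mpinv (drsubmx P) *m dlsubmx P = dlsubmx P.
Proof.
move=> pP; have [sP qP] := pP; have [sD qD] := psd_drsubmx pP.
set D := drsubmx P in sD qD *; set B := dlsubmx P; set X := mpinv D.
have [x1 x2 x3 x4] := mpinvP D; rewrite -/X in x1 x2 x3 x4.
pose E := 1%:M - D *m X.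
have sE : E^T = E by rewrite /E linearB /= trmx1 x3.
have ED : E *m D = 0 by rewrite /E mulmxBl mul1mx x1 subrr.
suff EB : E *m B = 0.
  by apply/esym/eqP; rewrite -subr_eq0 -{1}[B]mul1mx -mulmxBl EB.
apply/matrixP => i j; rewrite [RHS]mxE.
have h t : 0 <= qform (ulsubmx P) (delta_mx j 0) + 2 * t * ((E *m B) i j) +
    t ^+ 2 * 0.
  have := qP (col_mx (delta_mx j 0) (t *: (E *m delta_mx i 0))).
  rewrite qform_block// -/D -/B qformZv.
  have -> : qform D (E *m delta_mx i 0) = 0.
    by rewrite /qform trmx_mul sE -[_ *m D]mulmxA ED mulmx0 mul0mx mxE.
  have -> : ((t *: (E *m (delta_mx i 0 : 'cV_m)))^T *m B *m (delta_mx j 0 : 'cV_n)) 0 0 =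
      t * (E *m B) i j.
    rewrite linearZ /= -!scalemxAl mxE trmx_mul sE trmx_delta.
    by rewrite -[_ *m E *m B]mulmxA -rowE -colE !mxE.
  by rewrite mulrA.
have := quadratic_ge0_discr (lexx 0) h; rewrite mulr0 => h0.
by apply/eqP; rewrite -sqrf_eq0 eq_le h0 sqr_ge0.
Qed.

(** Completion of the square; [psd_range] supplies the cancellation that an inverse of [drsubmx P]
    would give. *)
Lemma qform_Pi P x u : psd P ->
  qform P (col_mx x u) =
  qform (Pi P) x + qform (drsubmx P) (u - Gamma P *m x).
Proof.
move=> pP; have [sP qP] := pP; have [sD qD] := psd_drsubmx pP.
have rg := psd_range pP.
rewrite qform_block// /Pi /Gamma mulNmx opprK.
set D := drsubmx P in sD qD rg *; set B := dlsubmx P in rg *.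
have -> : ursubmx P = B^T by rewrite sym_dlsubmx.
set X := mpinv D in rg *; have sX : X^T = X by exact: mpinv_sym.
rewrite qformB qformDv//.
have -> : bform D u (X *m B *m x) = (u^T *m B *m x) 0 0.
  by rewrite /bform -!mulmxA (mulmxA D) (mulmxA _ B) rg.
have -> : qform (B^T *m X *m B) x = qform D (X *m B *m x).
  rewrite -qform_conj trmx_mul sX -!mulmxA.
  by rewrite (mulmxA D X B) rg.
ring.
Qed.

Lemma Pi_le P x u : psd P -> qform (Pi P) x <= qform P (col_mx x u).
Proof.
by move=> pP; rewrite qform_Pi// ler_wpDr// (psd_drsubmx pP).2.
Qed.

Lemma Pi_Gamma P x : psd P ->
  qform P (col_mx x (Gamma P *m x)) = qform (Pi P) x.
Proof. by move=> pP; rewrite qform_Pi// subrr qform0v addr0. Qed.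

Lemma psd_Pi P : psd P -> psd (Pi P).
Proof.
move=> pP; split=> [|x]; last by rewrite -Pi_Gamma//; exact: pP.2.
have sD := (psd_drsubmx pP).1.
rewrite /Pi linearB /= !trmx_mul mpinv_sym// trmx_ulsub trmx_ursub trmx_dlsub.
by rewrite pP.1 mulmxA.
Qed.

(** The minimising control for [P'] is a competitor for [P]. *)
Lemma Pi_mono P P' : psd P -> psd P' -> mle P P' -> mle (Pi P) (Pi P').
Proof.
move=> pP pP' PP' x; rewrite -(Pi_Gamma _ pP').
exact: le_trans (Pi_le _ _ pP) (PP' _).
Qed.

(** Homogeneity is split into this inequality and [PiZ_le], both by a competitor argument, so that
    the pseudoinverse of [c *: P] is never computed, even at [c = 0]. *)
Lemma PiZ_ge P c : 0 <= c -> psd P -> mle (c *: Pi P) (Pi (c *: P)).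
Proof.
move=> c0 pP x; have pcP := psdZ c0 pP.
by rewrite -(Pi_Gamma _ pcP) !qformZ ler_wpM2l// Pi_le.
Qed.

Lemma PiZ_le P c : 0 <= c -> psd P -> mle (Pi (c *: P)) (c *: Pi P).
Proof.
move=> c0 pP x; have pcP := psdZ c0 pP.
by rewrite [leRHS]qformZ -(Pi_Gamma _ pP) -qformZ Pi_le.
Qed.

Lemma posdef_Pi P : posdef P -> posdef (Pi P).
Proof.
move=> pP; have pP' := posdef_psd pP; split=> [|x x0]; first exact: (psd_Pi pP').1.
rewrite -Pi_Gamma//; apply: pP.2; apply: contra_neq x0 => /eqP.
by rewrite col_mx_eq0 => /andP[/eqP].
Qed.

End SchurComplement.

(** * Value iteration and the Riccati equation *)

Section EntrywiseConvergence.
Context {R : realType}.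

Definition mcvg p q (A : nat -> 'M[R]_(p, q)) (B : 'M[R]_(p, q)) : Prop :=
  forall i j, (fun t => A t i j) @ \oo --> B i j.

Lemma cvg_sumr (I : Type) (r : seq I) (f : I -> nat -> R) (l : I -> R) :
  (forall i, f i @ \oo --> l i) ->
  (fun t => \sum_(i <- r) f i t) @ \oo --> \sum_(i <- r) l i.
Proof.
by move=> fl; apply: cvg_big => // x; exact: add_continuous.
Qed.

Lemma cvg_qform k (A : nat -> 'M[R]_k) B v :
  mcvg A B -> (fun t => qform (A t) v) @ \oo --> qform B v.
Proof.
move=> AB; under eq_fun do rewrite qformE.
rewrite qformE; apply: cvg_sumr => i; apply: cvg_sumr => j.
by apply: cvgMr_tmp; exact: AB.
Qed.

Lemma cvg_entry_sum k (A : nat -> 'M[R]_k) :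
  mcvg A 0 -> (fun t => entry_sum (A t)) @ \oo --> 0.
Proof.
move=> A0; have -> : 0 = entry_sum (0 : 'M[R]_k).
  by rewrite /entry_sum big1// => i _; rewrite big1// => j _; rewrite mxE normr0.
by apply: cvg_sumr => i; apply: cvg_sumr => j; apply: cvg_norm; exact: A0.
Qed.

Lemma mcvgB p q (A A' : nat -> 'M[R]_(p, q)) B B' :
  mcvg A B -> mcvg A' B' -> mcvg (fun t => A t - A' t) (B - B').
Proof.
move=> AB AB' i j; under eq_fun do rewrite !mxE.
by rewrite !mxE; apply: cvgB; [exact: AB | exact: AB'].
Qed.

Lemma mcvg_cst p q (B : 'M[R]_(p, q)) : mcvg (fun=> B) B.
Proof. by move=> i j; exact: cvg_cst. Qed.

Lemma mcvgZ p q c (A : nat -> 'M[R]_(p, q)) B :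
  mcvg A B -> mcvg (fun t => c *: A t) (c *: B).
Proof.
move=> AB i j; under eq_fun do rewrite mxE.
by rewrite mxE; apply: cvgMl_tmp; exact: AB.
Qed.

Lemma mcvg0_le k (A : nat -> 'M[R]_k) W e : posdef W -> 0 < e -> mcvg A 0 ->
  \forall t \near \oo, mle (A t) (e *: W).
Proof.
move=> pW e0 A0; have [C C0 CW] := posdef_dominates pW.
have A0' : (fun t => C * entry_sum (A t)) @ \oo --> 0.
  by rewrite -[X in _ --> X](mulr0 C); apply: cvgMl_tmp; exact: cvg_entry_sum.
near=> t; apply: mle_trans (CW _) _ => v.
rewrite !qformZ ler_wpM2r ?(posdef_psd pW).2//.
by near: t; exact: (cvgr_le 0).
Unshelve. all: by end_near. Qed.

Lemma mcvg_mle k (A : nat -> 'M[R]_k) B C :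
  mcvg A B -> (\forall t \near \oo, mle (A t) C) -> mle B C.
Proof.
move=> AB AC v; have := cvgr_to_le (cvg_qform (v := v) AB); apply.
by apply: filterS AC => t; exact.
Qed.

Lemma ge_mcvg_mle k (A : nat -> 'M[R]_k) B C :
  mcvg A B -> (\forall t \near \oo, mle C (A t)) -> mle C B.
Proof.
move=> AB AC v; have := cvgr_to_ge (cvg_qform (v := v) AB); apply.
by apply: filterS AC => t; exact.
Qed.

Lemma le_of_scaled (x y : R) : 0 <= x ->
  (forall e, 0 < e < 1 -> (1 - e) * x <= y) -> x <= y.
Proof.
move=> x0 h; rewrite leNgt; apply/negP => yx.
have := h (1 / 2); have -> : 0 < (1 / 2 : R) < 1 by apply/andP; split; lra.
move=> /(_ isT) y0; have xp : 0 < x by lra.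
have : 0 < (x - y) / (2 * x) < 1.
  by rewrite divr_gt0 ?subr_gt0 ?mulr_gt0//= ltr_pdivrMr ?mulr_gt0//; lra.
move=> /h; have -> : (1 - (x - y) / (2 * x)) * x = (x + y) / 2.
  by field; rewrite gt_eqF.
lra.
Qed.

End EntrywiseConvergence.

Section Riccati.
Context {R : realType}.
Variables (n m : nat) (F : 'M[R]_n -> 'M[R]_(n + m)) (E0 : 'M[R]_(n + m)).
Hypothesis E0_posdef : posdef E0.
Hypothesis F_psd : forall K, psd K -> psd (F K).
Hypothesis F_mono : forall K K', psd K -> psd K' -> mle K K' -> mle (F K) (F K').
Hypothesis F_affine : forall s K, 0 <= s -> psd K ->
  F (s *: K) = s *: F K + (1 - s) *: E0.

Definition value_iter (k : nat) : 'M[R]_n := iter k (fun K => Pi (F K)) 0.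

Lemma psd_value_iter k : psd (value_iter k).
Proof. by elim: k => [|k IH]; [exact: psd0 | exact/psd_Pi/F_psd]. Qed.

Lemma F0 : F 0 = E0.
Proof.
have := F_affine (lexx 0) (@psd0 R n).
by rewrite !scale0r add0r subr0 scale1r.
Qed.

Lemma E0_le_F K : psd K -> mle E0 (F K).
Proof.
move=> pK; rewrite -F0; apply: F_mono => //; first exact: psd0.
by move=> v; rewrite qform0 pK.2.
Qed.

Lemma posdef_F K : psd K -> posdef (F K).
Proof.
by move=> pK; apply: posdef_le (E0_le_F pK) => //; exact: (F_psd pK).1.
Qed.

Lemma value_iter_leS k : mle (value_iter k) (value_iter k.+1).
Proof.
elim: k => [v|k IH]; first by rewrite qform0 (psd_value_iter 1).2.
apply: (@Pi_mono _ _ _ (F (value_iter k)) (F (value_iter k.+1))).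
- exact/F_psd/psd_value_iter.
- exact/F_psd/psd_value_iter.
by apply: F_mono => //; exact: psd_value_iter.
Qed.

Lemma value_iter_le j k : (j <= k)%N -> mle (value_iter j) (value_iter k).
Proof.
elim: k => [|k IH]; first by rewrite leqn0 => /eqP ->; exact: mle_refl.
rewrite leq_eqVlt => /predU1P[->|]; first exact: mle_refl.
by rewrite ltnS => /IH h; apply: mle_trans h (value_iter_leS k).
Qed.

Lemma value_iter_le_sol K k : psd K -> K = Pi (F K) -> mle (value_iter k) K.
Proof.
move=> pK eK; elim: k => [v|k IH]; first by rewrite qform0 pK.2.
rewrite eK; apply: Pi_mono; [exact/F_psd/psd_value_iter | exact: F_psd |].
by apply: F_mono => //; exact: psd_value_iter.
Qed.

(* [F o Pi] contracts towards its fixed point in the order-unit gauge of that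
   fixed point. *)
Lemma F_contract K d s Q : psd K -> K = Pi (F K) -> mle (d *: F K) E0 ->
  1 <= s -> psd Q -> mle Q (s *: F K) ->
  mle (F (Pi Q)) ((1 + (s - 1) * (1 - d)) *: F K).
Proof.
move=> pK eK dE s1 pQ Qs; have s0 : 0 <= s by lra.
have pF := F_psd pK; have psF := psdZ s0 pF.
have h : mle (Pi Q) (s *: K).
  rewrite [K in s *: K]eK; apply: mle_trans (Pi_mono pQ psF Qs) _.
  exact: PiZ_le.
apply: mle_trans (F_mono (psd_Pi pQ) (psdZ s0 pK) h) _ => v.
rewrite F_affine// qformD !qformZ; have := dE v; rewrite qformZ => dv.
have : (s - 1) * (d * qform (F K) v) <= (s - 1) * qform E0 v.
  by rewrite ler_wpM2l// subr_ge0.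
lra.
Qed.

(** The contraction is applied to the fixed point [K'] itself: a bound of [F K'] by [(1 + c) F K]
    improves to [(1 + c (1 - d)) F K], and repeating this leaves [F K' <= F K]. *)
Lemma sol_le K K' : psd K -> K = Pi (F K) -> psd K' -> K' = Pi (F K') ->
  mle K' K.
Proof.
move=> pK eK pK' eK'; have [d /andP[d0 d1] dE] := posdef_rate (F K) E0_posdef.
have pW := posdef_F pK; have [C C0 CW] := posdef_dominates pW.
pose c := C * entry_sum (F K').
have c0 : 0 <= c by rewrite mulr_ge0 ?entry_sum_ge0.
have step j : mle (F K') ((1 + c * (1 - d) ^+ j) *: F K).
  elim: j => [|j IH].
    apply: mle_trans (CW _) _ => v; rewrite expr0 mulr1 !qformZ ler_wpM2r//.
      exact: (F_psd pK).2.
    by rewrite /c; lra.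
  rewrite {1}eK'; apply: mle_trans (F_contract _ _ dE _ _ IH) _ => //.
  - by rewrite lerDl mulr_ge0// exprn_ge0//; lra.
  - exact: F_psd.
  - by rewrite addrAC subrr add0r -mulrA -exprSr; exact: mle_refl.
have FF : mle (F K') (F K).
  move=> v.
  have cv : (fun j => (1 + c * (1 - d) ^+ j) * qform (F K) v) @ \oo -->
      (1 + c * 0) * qform (F K) v.
    apply: cvgMr_tmp; apply: cvgD; first exact: cvg_cst.
    by apply: cvgMl_tmp; apply: cvg_expr; rewrite ger0_norm; lra.
  have := cvgr_to_ge cv; rewrite mulr0 addr0 mul1r; apply.
  by apply: nearW => j; have := step j v; rewrite qformZ.
by rewrite eK eK'; apply: Pi_mono => //; exact: F_psd.
Qed.

Lemma sol_unique K K' : psd K -> K = Pi (F K) -> psd K' -> K' = Pi (F K') ->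
  K = K'.
Proof.
move=> pK eK pK' eK'; apply: mle_antisym; [exact: pK.1|exact: pK'.1|..];
exact: sol_le.
Qed.

(** Each scalar form converges by monotonicity, and polarization assembles the limits into a
    matrix. *)
Lemma value_iter_cvg : (forall v, exists b, forall k, qform (value_iter k) v <= b) ->
  exists K, [/\ psd K, K = Pi (F K) & mcvg value_iter K].
Proof.
move=> bnd.
have cq v : cvgn (fun k => qform (value_iter k) v).
  apply: nondecreasing_is_cvgn => [i j ij|]; first exact: value_iter_le.
  by have [b hb] := bnd v; exists b => _ [k _ <-].
pose l v := limn (fun k => qform (value_iter k) v).
pose K : 'M[R]_n := \matrix_(i, j)
  ((l (delta_mx i 0 + delta_mx j 0) - l (delta_mx i 0 - delta_mx j 0)) / 4).
have cK : mcvg value_iter K.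
  move=> i j; rewrite mxE.
  have -> : (fun k => value_iter k i j) = (fun k =>
      (qform (value_iter k) (delta_mx i 0 + delta_mx j 0) -
       qform (value_iter k) (delta_mx i 0 - delta_mx j 0)) / 4).
    apply/funext => k; rewrite -polarization ?(psd_value_iter k).1//.
    by field.
  by apply: cvgMr_tmp; apply: cvgB; exact: cq.
have leK k : mle (value_iter k) K.
  apply: ge_mcvg_mle cK _; near=> j; apply: value_iter_le.
  by near: j; exact: nbhs_infty_ge.
have pK : psd K.
  split=> [|v]; last first.
    by apply: le_trans (leK 0%N v); rewrite qform0.
  apply/matrixP => i j; rewrite !mxE [delta_mx j 0 + _]addrC.
  congr ((_ - _) / 4).
  rewrite /l; congr (limn _); apply/funext => k.
  by rewrite -opprB -scaleN1r qformZv sqrrN expr1n mul1r.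
(* [K] dominates the first iterate [Pi E0], which is definite; being definite, [K] is an order
   unit. *)
have posK : posdef K.
  apply: posdef_le (leK 1%N); first exact: pK.1.
  by apply: posdef_Pi; rewrite F0.
exists K; split => //; apply: mle_antisym; first exact: pK.1.
- exact: (psd_Pi (F_psd pK)).1.
- apply: (mcvg_mle cK); exists 1%N => // -[//|k] _ /=.
  apply: Pi_mono; [exact/F_psd/psd_value_iter | exact: F_psd |].
  by apply: F_mono => //; exact: psd_value_iter.
(* Some iterate [K_k] dominates [(1 - e) K]. Then [(1 - e) F K <= F ((1 - e) K) <= F K_k], and
   applying [Pi] gives [(1 - e) Pi (F K) <= K_{k+1} <= K]. *)
- move=> v; apply: le_of_scaled => [|e /andP[e0 e1]].
    exact: (psd_Pi (F_psd pK)).2.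
  have c0 : 0 <= 1 - e by lra.
  have : mcvg (fun k => K - value_iter k) 0.
    by rewrite -(subrr K); apply: mcvgB => //; exact: mcvg_cst.
  move=> /(mcvg0_le posK e0) /filter_ex[k hk].
  have {}hk : mle ((1 - e) *: K) (value_iter k).
    by move=> w; have := hk w; rewrite !qformZ qformB; lra.
  apply: le_trans (leK k.+1 v); rewrite -qformZ /=.
  apply: le_trans (PiZ_ge c0 (F_psd pK) v) _.
  apply: Pi_mono; [exact/psdZ/F_psd|exact/F_psd/psd_value_iter|].
  apply: mle_trans (F_mono (psdZ c0 pK) (psd_value_iter k) hk) => w.
  rewrite F_affine// qformD [leRHS]addrC lerDr qformZ mulr_ge0//; last first.
    exact: (posdef_psd E0_posdef).2.
  by lra.
Unshelve. all: by end_near. Qed.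

End Riccati.

(** * Comparison of paths with averaged noise *)

Section Averaging.
Context {R : realType}.
Variable al : nat -> R.
Hypothesis al01 : forall t, 0 <= al t <= 1.
Hypothesis al_sum : (\sum_(0 <= t <oo) (al t)%:E = +oo)%E.

Let al0 t : 0 <= al t. Proof. by case/andP: (al01 t). Qed.
Let al1 t : 0 <= 1 - al t. Proof. by rewrite subr_ge0; case/andP: (al01 t). Qed.

Lemma partial_sum_unbounded M : \forall t \near \oo, M <= \sum_(0 <= s < t) al s.
Proof.
have [[t0 ht0]|no] := pselect (exists t0, M <= \sum_(0 <= s < t0) al s).
  near=> t; apply: le_trans ht0 _.
  rewrite [leRHS](@big_cat_nat _ _ _ t0)//=; last by near: t; exact: nbhs_infty_ge.
  by rewrite lerDl sumr_ge0.
exfalso; suff : (+oo <= M%:E)%E by [].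
rewrite -al_sum; apply: lime_le.
  by apply: is_cvg_nneseries => k _ _; rewrite lee_fin.
apply: nearW => k; rewrite sumEFin lee_fin leNgt; apply/negP => h.
by apply: no; exists k; exact: ltW.
Unshelve. all: by end_near. Qed.

Definition decay (t0 t : nat) : R := \prod_(t0 <= s < t) (1 - al s).

Lemma decayS t0 t : (t0 <= t)%N -> decay t0 t.+1 = (1 - al t) * decay t0 t.
Proof. by move=> h; rewrite /decay big_nat_recr// mulrC. Qed.

Lemma decay_ge0 t0 t : 0 <= decay t0 t.
Proof. exact: prodr_ge0. Qed.

(** Since [(1 - a) * (1 + S + a) <= 1 + S], the product is at most the reciprocal of 1 plus the sum
    of the rates. *)
Lemma decay_cvg0 t0 : decay t0 @ \oo --> 0.
Proof.
have key t : (t0 <= t)%N -> decay t0 t * (1 + \sum_(t0 <= s < t) al s) <= 1.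
  elim: t => [|t IH]; first by rewrite leqn0 => /eqP ->; rewrite /decay !big_geq// addr0 mulr1.
  rewrite leq_eqVlt => /predU1P[<-|]; first by rewrite /decay !big_geq// addr0 mulr1.
  rewrite ltnS => h; apply: le_trans (IH h); rewrite decayS// big_nat_recr//=.
  set S := \sum_(_ <= _ < _) _; have S0 : 0 <= S by apply: sumr_ge0.
  have := decay_ge0 t0 t; have := al0 t; set D := decay _ _; set a := al t => a0 D0.
  rewrite mulrAC mulrC -subr_ge0.
  rewrite -mulrBr mulr_ge0//.
  by have := mulr_ge0 a0 S0; have := mulr_ge0 a0 a0; lra.
apply/cvgrPdist_le => e e0; near=> t.
rewrite sub0r normrN ger0_norm ?decay_ge0//.
have tt : (t0 <= t)%N by near: t; exact: nbhs_infty_ge.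
have : e^-1 + \sum_(0 <= s < t0) al s <= \sum_(0 <= s < t) al s.
  by near: t; exact: partial_sum_unbounded.
rewrite [leRHS](@big_cat_nat _ _ _ t0)//= [leLHS]addrC lerD2l => h.
have := key t tt; have := decay_ge0 t0 t; set D := decay _ _ => D0 k1.
have : D * e^-1 <= 1.
  by apply: le_trans k1; rewrite ler_wpM2l//; lra.
by rewrite ler_pdivrMr// mul1r.
Unshelve. all: by end_near. Qed.

Lemma averaging_vanishes (v r : nat -> R) :
  (forall t, v t.+1 = (1 - al t) * v t + al t * r t) ->
  r @ \oo --> 0 -> v @ \oo --> 0.
Proof.
move=> vS r0; apply/cvgrPdist_le => e e0.
have e20 : 0 < e / 2 by rewrite divr_gt0.
have [t0 _ ht0] := cvgr0_norm_le _ r0 _ e20.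
(* The level [e / 2] is preserved by convex combinations, so only the value at [t0] remains, damped
   by [decay]. *)
have key t : (t0 <= t)%N -> `|v t| <= e / 2 + decay t0 t * `|v t0|.
  elim: t => [|t IH].
    by rewrite leqn0 => /eqP ->; rewrite /decay !big_geq// mul1r lerDr ltW.
  rewrite leq_eqVlt => /predU1P[<-|].
    by rewrite /decay !big_geq// mul1r lerDr ltW.
  rewrite ltnS => h; rewrite vS decayS//.
  apply: le_trans (ler_normD _ _) _.
  rewrite !normrM (ger0_norm (al0 t)) (ger0_norm (al1 t)).
  have a : (1 - al t) * `|v t| <= (1 - al t) * (e / 2 + decay t0 t * `|v t0|).
    by rewrite ler_wpM2l// IH.
  have b : al t * `|r t| <= al t * (e / 2) by rewrite ler_wpM2l// ht0.
  have -> : e / 2 + (1 - al t) * decay t0 t * `|v t0| = (1 - al t) *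
    (e / 2 + decay t0 t * `|v t0|) + al t * (e / 2) by ring.
  exact: lerD.
have d0 : (fun t => decay t0 t * `|v t0|) @ \oo --> 0.
  by rewrite -[X in _ --> X](mul0r `|v t0|); apply: cvgMr_tmp; exact: decay_cvg0.
near=> t; rewrite sub0r normrN; apply: le_trans (key t _) _.
  by near: t; exact: nbhs_infty_ge.
rewrite [leRHS](splitr e) lerD2l; near: t; exact: (cvgr_le 0).
Unshelve. all: by end_near. Qed.

Fixpoint average (e : nat -> R) t : R :=
  if t is s.+1 then (1 - al s) * average e s + al s * e s else 0.

(* Kronecker-type argument: correcting the average by the tail [l - S t] of the
   series turns it into an average of that vanishing tail. *)
Lemma average_cvg0 (e : nat -> R) :
  cvgn (fun t => \sum_(0 <= s < t) al s * e s) -> average e @ \oo --> 0.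
Proof.
move=> /cvg_ex[l Sl]; pose S t := \sum_(0 <= s < t) al s * e s.
have r0 : (fun t => l - S t) @ \oo --> 0.
  by rewrite -[X in _ --> X](subrr l); apply: cvgB => //; exact: cvg_cst.
have v0 : (fun t => average e t + (l - S t)) @ \oo --> 0.
  apply: averaging_vanishes r0 => t; rewrite /S big_nat_recr//=; ring.
have -> : average e = fun t => (average e t + (l - S t)) - (l - S t).
  by apply/funext => t; rewrite addrK.
by rewrite -[X in _ --> X](subrr 0); exact: cvgB.
Qed.

Lemma average_sum (I : Type) (r : seq I) (f : I -> nat -> R) t :
  average (fun s => \sum_(i <- r) f i s) t = \sum_(i <- r) average (f i) t.
Proof.
elim: t => [|t IH] /=; first by rewrite big1.
by rewrite IH big_split /= -!mulr_sumr.
Qed.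

Lemma averageD (f g : nat -> R) t :
  average (fun s => f s + g s) t = average f t + average g t.
Proof. by elim: t => [|t IH] /=; rewrite ?addr0// IH; ring. Qed.

Fixpoint mx_average k (E : nat -> 'M[R]_k) t : 'M[R]_k :=
  if t is s.+1 then (1 - al s) *: mx_average E s + al s *: E s else 0.

Lemma mx_averageE k (E : nat -> 'M[R]_k) t i j :
  mx_average E t i j = average (fun s => E s i j) t.
Proof. by elim: t => [|t IH] /=; rewrite ?mxE// -IH. Qed.

Lemma mx_averageZ k c (E : nat -> 'M[R]_k) t :
  mx_average (fun s => c *: E s) t = c *: mx_average E t.
Proof.
elim: t => [|t IH] /=; first by rewrite scaler0.
by rewrite IH scalerDr !scalerA [c * al t]mulrC [c * (1 - al t)]mulrC.
Qed.

(** Subtracting the averaged noise and [B] from [D] leaves [Z] with [Z t.+1 <= (1 - al t) *: Z t],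
    which dies out with [decay]. Half of [eta] pays for [Z], half for the noise. The average starts
    at time 0, not [t0]; [Z t0] absorbs the difference. *)
Lemma averaged_le k (D E : nat -> 'M[R]_k) B W t0 eta :
  posdef W -> 0 < eta -> mcvg (mx_average E) 0 ->
  (forall t, (t0 <= t)%N ->
     mle (D t.+1) ((1 - al t) *: D t + al t *: (B + E t))) ->
  \forall t \near \oo, mle (D t) (B + eta *: W).
Proof.
move=> pW eta0 E0 DS; have [C C0 CW] := posdef_dominates pW.
have eta20 : 0 < eta / 2 by rewrite divr_gt0.
pose Z t := D t - mx_average E t - B.
pose c := C * entry_sum (Z t0).
have q0 v := (posdef_psd pW).2 v.
have key t : (t0 <= t)%N -> mle (Z t) ((decay t0 t * c) *: W).
  elim: t => [|t IH].
    rewrite leqn0 => /eqP h; subst t0.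
    by rewrite /decay !big_geq// mul1r; exact: CW.
  rewrite leq_eqVlt => /predU1P[h|].
    by rewrite -h /decay !big_geq// mul1r; exact: CW.
  rewrite ltnS => h v; have := DS t h v; have := IH h v.
  rewrite /Z /= decayS// !(qformB, qformD, qformZ) => h1 h2.
  have := ler_wpM2l (al1 t) h1; lra.
have d0 : (fun t => decay t0 t * c) @ \oo --> 0.
  by rewrite -[X in _ --> X](mul0r c); apply: cvgMr_tmp; exact: decay_cvg0.
near=> t => v.
have : qform (Z t) v <= eta / 2 * qform W v.
  apply: (@le_trans _ _ (decay t0 t * c * qform W v)).
    by rewrite -qformZ; apply: key; near: t; exact: nbhs_infty_ge.
  by rewrite ler_wpM2r//; near: t; exact: (cvgr_le 0).
have : qform (mx_average E t) v <= eta / 2 * qform W v.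
  by rewrite -qformZ; move: v; near: t; exact: mcvg0_le.
rewrite /Z !(qformB, qformD, qformZ); lra.
Unshelve. all: by end_near. Qed.

End Averaging.

(** * Lower and upper comparison along a single path *)

Section PathwiseIteration.
Context {R : realType}.
Variables (n m : nat) (F : 'M[R]_n -> 'M[R]_(n + m)) (E0 : 'M[R]_(n + m)).
Hypothesis E0_posdef : posdef E0.
Hypothesis F_psd : forall K, psd K -> psd (F K).
Hypothesis F_mono : forall K K', psd K -> psd K' -> mle K K' -> mle (F K) (F K').
Hypothesis F_affine : forall s K, 0 <= s -> psd K ->
  F (s *: K) = s *: F K + (1 - s) *: E0.
Variable al : nat -> R.
Hypothesis al01 : forall t, 0 <= al t <= 1.
Hypothesis al_sum : (\sum_(0 <= t <oo) (al t)%:E = +oo)%E.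
Variables (Nn Q : nat -> 'M[R]_(n + m)) (Ln : nat -> 'M[R]_(n, n + m)).
Hypothesis Nn_psd : forall t, psd (Nn t).
Hypothesis Q_psd : forall t, psd (Q t).
Hypothesis Q_rec : forall t, Q t.+1 =
  (1 - al t) *: Q t + al t *: (Nn t + (Ln t)^T *m Pi (Q t) *m Ln t).

Definition backup_noise (K : 'M[R]_n) (t : nat) : 'M[R]_(n + m) :=
  Nn t + (Ln t)^T *m K *m Ln t - F K.

Let al0 t : 0 <= al t. Proof. by case/andP: (al01 t). Qed.
Let al1 t : 0 <= 1 - al t. Proof. by rewrite subr_ge0; case/andP: (al01 t). Qed.

(** Shrinking the semidefinite [Nn t] by [c = 1 - e / 2], the backup of [Q t] dominates [c] times
    [F K] plus noise once [Pi (Q t)] dominates [c *: K]; [averaged_le] is then applied to [- Q]. *)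
Lemma lower_step K :
  psd K -> mcvg (mx_average al (backup_noise K)) 0 ->
  (forall e, 0 < e < 1 -> \forall t \near \oo, mle ((1 - e) *: K) (Pi (Q t))) ->
  forall e, 0 < e < 1 -> \forall t \near \oo, mle ((1 - e) *: F K) (Q t).
Proof.
move=> pK K0 KQ e /andP[e0 e1]; have pF := posdef_F E0_posdef F_psd F_mono F_affine pK.
have e20 : 0 < e / 2 by rewrite divr_gt0.
have [|t0 _ ht0] := KQ (e / 2); first by apply/andP; split; lra.
pose c := 1 - e / 2; have c0 : 0 <= c by rewrite /c; lra.
have E1 : mcvg (mx_average al (fun t => - c *: backup_noise K t)) 0.
  have := mcvgZ (c := - c) K0; rewrite scaler0.
  by under [in X in X -> _]eq_fun do rewrite -mx_averageZ.
have : \forall t \near \oo, mle (- Q t) (- c *: F K + (e / 2) *: F K).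
  apply: (averaged_le al01 al_sum (t0 := t0) pF e20 E1) => t tt v.
  have qN := (Nn_psd t).2 v; have := ht0 t tt (Ln t *m v).
  rewrite Q_rec /backup_noise; move: (Pi (Q t)) => X.
    rewrite !(qformZ, qformD, qformN, qform_conj) -/c => h.
  have : c * (qform (Nn t) v + qform K (Ln t *m v)) <=
      qform (Nn t) v + qform X (Ln t *m v).
    by rewrite mulrDr lerD// ler_piMl// /c; lra.
  move=> /(ler_wpM2l (al0 t)); lra.
apply: filterS => t h v; have := h v.
rewrite !(qformZ, qformD, qformN) /c; lra.
Qed.

(** Homogeneity of [Pi] turns the conclusion of [lower_step] at [k] into its premise at [k + 1]. *)
Lemma lower_bound :
  (forall k, mcvg (mx_average al (backup_noise (value_iter F k))) 0) ->
  forall k e, 0 < e < 1 ->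
    \forall t \near \oo, mle ((1 - e) *: F (value_iter F k)) (Q t).
Proof.
move=> K0 k; have pk j := psd_value_iter F_psd j.
elim: k => [|k IH]; apply: lower_step => // e he.
  by apply: nearW => t v; rewrite scaler0 qform0 (psd_Pi (Q_psd t)).2.
have c0 : 0 <= 1 - e by case/andP: he => *; lra.
have := IH e he; apply: filterS => t h.
apply: mle_trans (PiZ_ge c0 (F_psd (pk k))) _.
by apply: Pi_mono => //; apply: psdZ => //; exact: F_psd.
Qed.

Section UpperBound.
Variables (K : 'M[R]_n) (d : R).
Hypothesis K_psd : psd K.
Hypothesis K_sol : K = Pi (F K).
Hypothesis d01 : 0 < d < 1.
Hypothesis d_rate : mle (d *: F K) E0.

(* [g t] is a running scale for [Q t], reset only when [Q] outgrows it. *)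
Variable g : nat -> R.
Hypothesis g_ge2 : forall t, 2 <= g t.
Hypothesis g_keep : forall t,
  mle (Q t.+1) (((1 + d / 2) * g t) *: F K) -> g t.+1 = g t.
Hypothesis g_reset : forall t,
  ~ mle (Q t.+1) (((1 + d / 2) * g t) *: F K) -> mle (Q t.+1) (g t.+1 *: F K).
Hypothesis noise_cvg : mcvg (mx_average al
  (fun t => (g t)^-1 *: backup_noise (Pi (Q t)) t)) 0.

Let pW : posdef (F K).
Proof. by have := posdef_F E0_posdef F_psd F_mono F_affine K_psd. Qed.

Let q0 v : 0 <= qform (F K) v.
Proof. exact: (posdef_psd pW).2. Qed.

(** Once the normalised averages [A] stay within [d / 4] of 0 in the gauge of [F K], start at a time
    [t0] with [Q <= c F K], [c = g t0]. The bound [Q - c A <= c (1 + d / 4) F K] is then preserved,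
    whence [Q <= c (1 + d / 2) F K], which is exactly the condition for keeping the scale. *)
Lemma scale_eventually_constant : exists c, 0 < c /\
  \forall t \near \oo, g t = c /\ mle (Q t) (((1 + d / 2) * c) *: F K).
Proof.
have /andP[d0 d1] := d01; have d40 : 0 < d / 4 by rewrite divr_gt0.
pose A := mx_average al (fun t => (g t)^-1 *: backup_noise (Pi (Q t)) t).
have : \forall t \near \oo, mle (A t) ((d / 4) *: F K) /\
    mle (- A t) ((d / 4) *: F K).
  have A0' : mcvg (fun t => - A t) 0.
    have := mcvgZ (c := - 1) noise_cvg; rewrite scaler0.
    by under [in X in X -> _]eq_fun do rewrite scaleN1r.
  near=> t; split; near: t; exact: mcvg0_le.
move=> [t1 _ ht1].
(* If [Q t <= g t F K] never holds from [t1] on, no reset happens there either, because a reset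
   produces this very inequality. *)
have [[t0 [tt0 Qt0]]|no] :=
    pselect (exists t0, (t1 <= t0)%N /\ mle (Q t0) (g t0 *: F K)); last first.
  have step t : (t1 <= t)%N -> g t = g t1 /\
      mle (Q t.+1) (((1 + d / 2) * g t1) *: F K).
    move=> tt; have kp s : (t1 <= s)%N -> mle (Q s.+1) (((1 + d / 2) * g s) *: F K).
      move=> ts; apply: contrapT => h; apply: no; exists s.+1; split.
        exact: leqW.
      exact: g_reset.
    have gt : g t = g t1.
      elim: t tt => [|t IH]; first by rewrite leqn0 => /eqP ->.
      rewrite leq_eqVlt => /predU1P[<-//|]; rewrite ltnS => h.
      by rewrite g_keep ?IH//; rewrite -?IH//; exact: kp.
    by split=> //; rewrite -gt; exact: kp.
  exists (g t1); split; first by have := g_ge2 t1; lra.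
  exists t1.+1 => // -[//|t]/= tt; have [] := step t tt; split=> //.
  by have [] := step t.+1 (leqW tt).
set c := g t0; have c2 : 2 <= c by exact: g_ge2.
have key t : (t0 <= t)%N -> g t = c /\
    mle (Q t - c *: A t) ((c * (1 + d / 4)) *: F K).
  have base : mle (Q t0 - c *: A t0) ((c * (1 + d / 4)) *: F K).
    move=> v; have := Qt0 v; have := (ht1 t0 tt0).2 v.
    rewrite !(qformB, qformN, qformZ) -/c => h1 h2.
    have := ler_wpM2l (_ : 0 <= c) h1; lra.
  elim: t => [|t IH]; first by rewrite leqn0 => /eqP h; subst t0.
  rewrite leq_eqVlt => /predU1P[<-//|].
  rewrite ltnS => h; have [gt Zt] := IH h.
  have tt1 : (t1 <= t)%N by exact: leq_trans h.
  have bd s : (t1 <= s)%N -> mle (Q s - c *: A s) ((c * (1 + d / 4)) *: F K) ->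
      mle (Q s) (((1 + d / 2) * c) *: F K).
    move=> ts hs v; have := hs v; have := (ht1 s ts).1 v.
    rewrite !(qformB, qformN, qformZ) => h1 h2.
    have := ler_wpM2l (_ : 0 <= c) h1; lra.
  have Z' : mle (Q t.+1 - c *: A t.+1) ((c * (1 + d / 4)) *: F K).
    have s1 : 1 <= (1 + d / 2) * c by nra.
    have FP := F_contract F_psd F_mono F_affine K_psd K_sol d_rate s1 (Q_psd t)
      (bd t tt1 Zt).
    move=> v; have := FP v; have := Zt v.
    rewrite /A /= -/(A t) Q_rec /backup_noise gt; move: (Pi (Q t)) => X.
    rewrite !(qformB, qformN, qformD, qformZ, qform_conj) => h1 h2.
    (* The left factor is [d + c (1 - d / 2 - d^2 / 2)]; it is at most [c (1 + d / 4)] because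
       [c >= 2]. *)
    have h3 : (1 + ((1 + d / 2) * c - 1) * (1 - d)) * qform (F K) v <=
        (c * (1 + d / 4)) * qform (F K) v.
      by rewrite ler_wpM2r//; nra.
    have := ler_wpM2l (al0 t) (le_trans h2 h3); have := ler_wpM2l (al1 t) h1.
    have cc x : c * (c^-1 * x) = x by rewrite mulrA divff ?mul1r//; lra.
    have e1 y z : c * (y + al t * (c^-1 * z)) = c * y + al t * z.
      by rewrite mulrDr mulrCA cc.
    rewrite e1; lra.
  split=> //; rewrite g_keep// gt; apply: bd => //; exact: leqW.
exists c; split; first by lra.
exists t0 => // t /= tt; have [gt Zt] := key t tt; split=> // v.
have := Zt v; have := (ht1 t (leq_trans tt0 tt)).1 v.
rewrite !(qformB, qformN, qformZ) => h1 h2.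
have := ler_wpM2l (_ : 0 <= c) h1; lra.
Unshelve. all: by end_near. Qed.

Lemma upper_limit e : 0 < e -> \forall t \near \oo, mle (Q t) ((1 + e) *: F K).
Proof.
move=> e0; have /andP[d0 d1] := d01.
have [c [c0 [t0 _ ht0]]] := scale_eventually_constant.
have c2 : 2 <= c by have [<- _] := ht0 t0 (leqnn _).
(* [u j] is the excess over 1 of the multiple of [F K] that bounds [Q] after [j] rounds. The
   contraction takes away the share [d], averaging gives back [d / 2] as slack, so the ratio is
   [1 - d / 2]. *)
pose u j := ((1 + d / 2) * c - 1) * (1 - d / 2) ^+ j.
have u0 j : 0 < u j.
  by rewrite mulr_gt0 ?exprn_gt0//; [nra|lra].
have noise0 : mcvg (mx_average al
    (fun t => c *: ((g t)^-1 *: backup_noise (Pi (Q t)) t))) 0.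
  have := mcvgZ (c := c) noise_cvg; rewrite scaler0.
  by under [in X in X -> _]eq_fun do rewrite -mx_averageZ.
have step j : \forall t \near \oo, mle (Q t) ((1 + u j) *: F K).
  elim: j => [|j [t1 _ IH]].
    exists t0 => // t /ht0[_]; rewrite /u expr0 mulr1.
    by have -> : 1 + ((1 + d / 2) * c - 1) = (1 + d / 2) * c by ring.
  have eta0 : 0 < u j * (d / 2) by rewrite mulr_gt0// divr_gt0.
  have : \forall t \near \oo, mle (Q t)
      ((1 + u j * (1 - d)) *: F K + (u j * (d / 2)) *: F K).
    apply: (averaged_le al01 al_sum (t0 := maxn t0 t1) pW eta0 noise0) => t.
    rewrite geq_max => /andP[tt0 tt1] v; have [gt _] := ht0 t tt0.
    have s1 : 1 <= 1 + u j by rewrite lerDl ltW.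
    have := F_contract F_psd F_mono F_affine K_psd K_sol d_rate s1 (Q_psd t)
      (IH t tt1) v.
    have -> : 1 + u j - 1 = u j by ring.
    rewrite gt scalerA divff ?scale1r; last by rewrite gt_eqF.
    rewrite Q_rec /backup_noise; move: (Pi (Q t)) => X.
    rewrite !(qformB, qformN, qformD, qformZ, qform_conj).
    by move=> /(ler_wpM2l (al0 t)); lra.
  apply: filterS => t; rewrite -scalerDl.
  by have -> : 1 + u j * (1 - d) + u j * (d / 2) = 1 + u j.+1
    by rewrite /u exprS; field.
have : u @ \oo --> 0.
  rewrite -[X in _ --> X](mulr0 ((1 + d / 2) * c - 1)); apply: cvgMl_tmp.
  by apply: cvg_expr; rewrite ger0_norm; lra.
move=> /cvgr_le /(_ e e0) /filter_ex[j uj].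
apply: filterS (step j) => t h; apply: mle_trans h _ => v.
by rewrite !qformZ ler_wpM2r// lerD2l.
Qed.

End UpperBound.

Lemma iteration_cvg K d g : psd K -> K = Pi (F K) -> 0 < d < 1 ->
  mle (d *: F K) E0 -> (forall t, 2 <= g t) ->
  (forall t, mle (Q t.+1) (((1 + d / 2) * g t) *: F K) -> g t.+1 = g t) ->
  (forall t, ~ mle (Q t.+1) (((1 + d / 2) * g t) *: F K) ->
     mle (Q t.+1) (g t.+1 *: F K)) ->
  mcvg (mx_average al (fun t => (g t)^-1 *: backup_noise (Pi (Q t)) t)) 0 ->
  (forall k, mcvg (mx_average al (backup_noise (value_iter F k))) 0) ->
  mcvg Q (F K).
Proof.
move=> pK eK d01 dE g2 gk gr noise lnoise.
have pW := posdef_F E0_posdef F_psd F_mono F_affine pK.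
have [v|K' [pK' eK' cK']] := value_iter_cvg E0_posdef F_psd F_mono F_affine.
  by exists (qform K v) => k; exact: value_iter_le_sol.
have KK : K' = K by exact: (sol_unique E0_posdef F_psd F_mono F_affine).
rewrite {}KK in pK' eK' cK'.
have pK1 : posdef K by rewrite eK; exact: posdef_Pi.
have main e : 0 < e < 1 -> \forall t \near \oo,
    mle ((1 - e) *: F K) (Q t) /\ mle (Q t) ((1 + e) *: F K).
  (* For the lower bound the factor [1 - e / 2] is lost twice, from [K] to [K_k] and from [F K_k] to
     [Q t]; its square is at least [1 - e]. *)
  move=> /andP[e0 e1]; have e20 : 0 < e / 2 by rewrite divr_gt0.
  have c0 : 0 <= 1 - e / 2 by lra.
  have he : 0 < e / 2 < 1 by apply/andP; split; lra.
  have : mcvg (fun k => K - value_iter F k) 0.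
    by rewrite -(subrr K); apply: mcvgB => //; exact: mcvg_cst.
  move=> /(mcvg0_le pK1 e20) /filter_ex[k hk].
  have {}hk : mle ((1 - e / 2) *: K) (value_iter F k).
    by move=> w; have := hk w; rewrite !qformZ qformB; lra.
  have {}hk := F_mono (psdZ c0 pK) (psd_value_iter F_psd k) hk.
  have ul := upper_limit pK eK d01 dE g2 gk gr noise e0.
  near=> t; split; last first.
    by near: t; exact: ul.
  have hQ : mle ((1 - e / 2) *: F (value_iter F k)) (Q t).
    by near: t; exact: lower_bound.
  move=> v; have := hk v; have := hQ v; have := (posdef_psd pW).2 v.
  rewrite F_affine// !(qformD, qformZ); have := (posdef_psd E0_posdef).2 v.
  move=> h1 h2 h3 h4.
  have : 0 <= (1 - (1 - e / 2)) * qform E0 v by rewrite mulr_ge0//; lra.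
  move=> h5; have : (1 - e / 2) * qform (F K) v <= qform (F (value_iter F k)) v by lra.
  move=> /(ler_wpM2l c0); nra.
move=> i j; apply/cvgrPdist_le => e e0.
pose b := F K i i + F K j j.
have b0 : 0 <= b.
  by apply: addr_ge0; rewrite -bform_delta; exact: (posdef_psd pW).2.
(* [b + 1] is positive even if [b = 0], and the minimum keeps [e'] below 1. *)
pose e' := Num.min (e / (b + 1)) (1 / 2).
have e'0 : 0 < e' < 1.
  rewrite lt_min gt_min; apply/andP; split.
    by apply/andP; split; [rewrite divr_gt0//|]; lra.
  by apply/orP; right; lra.
apply: filterS (main e' e'0) => t [h1 h2].
have sQ : (F K - Q t)^T = F K - Q t.
  by rewrite linearB /= pW.1 (Q_psd t).1.
have : `|(F K - Q t) i j| <= (e' *: F K) i i + (e' *: F K) j j.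
  apply: entry_le => // v; have := h1 v; have := h2 v.
  by rewrite !(qformB, qformZ) ler_norml => *; apply/andP; split; lra.
rewrite !mxE -mulrDr -/b => /le_trans; apply.
have : e' <= e / (b + 1) by rewrite ge_min lexx.
rewrite ler_pdivlMr; last by lra.
by case/andP: e'0 => *; nra.
Unshelve. all: by end_near. Qed.

End PathwiseIteration.

(** * Measurability of matrix-valued functions *)

Section MeasurableMatrices.
Context {R : realType} {d : measure_display} {T : measurableType d}.

Definition mx_measurable p q (A : T -> 'M[R]_(p, q)) : Prop :=
  forall i j, measurable_fun setT (fun w => A w i j).

Lemma mx_measurable_cst p q (A : 'M[R]_(p, q)) : mx_measurable (fun=> A).
Proof. by move=> i j; exact: measurable_cst. Qed.

Lemma mx_measurableD p q (A B : T -> 'M[R]_(p, q)) :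
  mx_measurable A -> mx_measurable B -> mx_measurable (fun w => A w + B w).
Proof.
move=> mA mB i j; under eq_fun do rewrite mxE.
by apply: measurable_funD; [exact: mA | exact: mB].
Qed.

Lemma mx_measurableZ p q (c : T -> R) (A : T -> 'M[R]_(p, q)) :
  measurable_fun setT c -> mx_measurable A -> mx_measurable (fun w => c w *: A w).
Proof.
move=> mc mA i j; under eq_fun do rewrite mxE.
by apply: measurable_funM => //; exact: mA.
Qed.

Lemma mx_measurableM p q r (A : T -> 'M[R]_(p, q)) (B : T -> 'M[R]_(q, r)) :
  mx_measurable A -> mx_measurable B -> mx_measurable (fun w => A w *m B w).
Proof.
move=> mA mB i j; under eq_fun do rewrite mxE.
by apply: measurable_sum => k; apply: measurable_funM; [exact: mA | exact: mB].
Qed.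

Lemma mx_measurable_tr p q (A : T -> 'M[R]_(p, q)) :
  mx_measurable A -> mx_measurable (fun w => (A w)^T).
Proof. by move=> mA i j; under eq_fun do rewrite mxE; exact: mA. Qed.

Lemma mx_measurable_col p q r (A : T -> 'M[R]_(p, r)) (B : T -> 'M[R]_(q, r)) :
  mx_measurable A -> mx_measurable B ->
  mx_measurable (fun w => col_mx (A w) (B w)).
Proof.
move=> mA mB i j; under eq_fun do rewrite mxE.
by case: (fintype.split i) => k; [exact: mA | exact: mB].
Qed.

Lemma measurable_qform k (A : T -> 'M[R]_k) (v : T -> 'cV[R]_k) :
  mx_measurable A -> mx_measurable v ->
  measurable_fun setT (fun w => qform (A w) (v w)).
Proof.
move=> mA mv; apply: mx_measurableM => //; apply: mx_measurableM => //.
exact: mx_measurable_tr.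
Qed.

Lemma measurable_entry_sum k (A : T -> 'M[R]_k) :
  mx_measurable A -> measurable_fun setT (fun w => entry_sum (A w)).
Proof.
move=> mA; apply: measurable_sum => i; apply: measurable_sum => j.
by apply: measurableT_comp => //; exact: mA.
Qed.

Lemma mxborel_mx_measurable p q (A : T -> mxborel R p q) :
  measurable_fun setT A -> mx_measurable (A : T -> 'M[R]_(p, q)).
Proof.
move=> mA i j _ B mB; rewrite setTI.
have := mA measurableT [set M : 'M[R]_(p, q) | B (M i j)].
rewrite setTI; apply; apply: sub_sigma_algebra; exists i, j, B; split => //.
Qed.

Lemma mx_measurable_mxborel p q (A : T -> 'M[R]_(p, q)) :
  mx_measurable A -> measurable_fun setT (A : T -> mxborel R p q).
Proof.
move=> mA; apply: (@measurability _ _ _ (mxborel R p q) _ _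
  (@entry_cylinders R p q)) => //.
by move=> _ [_ [i [j [B [mB ->]]]] <-]; exact: mA.
Qed.

End MeasurableMatrices.

(** * Countable tests by rational vectors *)

Section RationalVectors.
Context {R : realType}.

Definition ratv k (v : 'cV[rat]_k) : 'cV[R]_k := map_mx (ratr : rat -> R) v.

Lemma ratv_dense k (v : 'cV[R]_k) :
  exists r : nat -> 'cV[rat]_k, mcvg (fun t => ratv (r t)) v.
Proof.
have [f hf] : exists f : nat -> 'I_k -> rat,
    forall t i, v i 0 < ratr (f t i) < v i 0 + t.+1%:R^-1.
  have /choice[f hf] : forall ti : nat * 'I_k, exists q : rat,
      v ti.2 0 < ratr q < v ti.2 0 + ti.1.+1%:R^-1.
    move=> [t i] /=; have /rat_in_itvoo[q] : v i 0 < v i 0 + t.+1%:R^-1.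
      by rewrite ltrDl.
    by rewrite in_itv /= => hq; exists q.
  by exists (fun t i => f (t, i)) => t i; exact: (hf (t, i)).
exists (fun t => \col_i f t i) => i j; rewrite ord1.
under eq_fun do rewrite !mxE.
apply/cvgrPdist_le => e e0; near=> t.
have /andP[h1 h2] := hf t i.
have h3 : ratr (f t i) < v i 0 + e.
  apply: lt_trans h2 _; rewrite ltrD2l.
  by near: t; exact: (near_infty_natSinv_lt (PosNum e0)).
by rewrite ler_norml; apply/andP; split; lra.
Unshelve. all: by end_near. Qed.

Lemma cvg_qform_ratv k (A : 'M[R]_k) (r : nat -> 'cV[R]_k) v :
  mcvg r v -> (fun t => qform A (r t)) @ \oo --> qform A v.
Proof.
move=> rv; under eq_fun do rewrite qformE.
rewrite qformE; apply: cvg_sumr => i; apply: cvg_sumr => j.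
by apply: cvgMl_tmp; apply: cvgM; exact: rv.
Qed.

Lemma mle_ratv k (A B : 'M[R]_k) :
  (forall q, qform A (ratv q) <= qform B (ratv q)) -> mle A B.
Proof.
move=> h v; have [r rv] := ratv_dense v.
rewrite -subr_ge0 -qformB.
have := cvgr_to_ge (cvg_qform_ratv (A := B - A) rv); apply.
by apply: nearW => t; rewrite qformB subr_ge0.
Qed.

Lemma Pi_ge_ratv n m (P : 'M[R]_(n + m)) x c : psd P ->
  (forall q, c <= qform P (col_mx x (ratv q))) -> c <= qform (Pi P) x.
Proof.
move=> pP h; rewrite -Pi_Gamma//; set u := Gamma P *m x.
have [r ru] := ratv_dense u.
have cv : mcvg (fun t => col_mx x (ratv (r t))) (col_mx x u).
  move=> i j; under eq_fun do rewrite mxE.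
  have -> : col_mx x u i j = match fintype.split i with
    | inl k => x k j | inr k => u k j end by rewrite mxE.
  by case: (fintype.split i) => k; [exact: cvg_cst | exact: ru].
have := cvgr_to_ge (cvg_qform_ratv (A := P) cv); apply.
by apply: nearW => t; exact: h.
Qed.

Context {d : measure_display} {T : measurableType d}.

Lemma countable_bigcap_measurable (C : countType) (F : C -> set T) :
  (forall q, measurable (F q)) -> measurable (\bigcap_(q in [set: C]) F q).
Proof.
move=> mF.
have -> : \bigcap_(q in [set: C]) F q =
    \bigcap_k (if unpickle k is Some q then F q else setT).
  apply/seteqP; split => w h => [k _|q _]; first by case: unpickle => // q; exact: h.
  by have := h (pickle q) I; rewrite /= pickleK.
by apply: bigcapT_measurable => k; case: unpickle.
Qed.

Lemma measurable_mle k (A B : T -> 'M[R]_k) :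
  mx_measurable A -> mx_measurable B -> measurable [set w | mle (A w) (B w)].
Proof.
move=> mA mB.
have -> : [set w | mle (A w) (B w)] = \bigcap_(q in [set: 'cV[rat]_k])
    [set w | qform (A w) (ratv q) <= qform (B w) (ratv q)].
  apply/seteqP; split => w /= h; last by apply: mle_ratv => q; exact: h.
  by move=> q _; exact: h.
apply: countable_bigcap_measurable => q.
have mq : measurable_fun setT (fun w => qform (A w) (ratv q) <= qform (B w) (ratv q)).
  by apply: measurable_fun_ler; apply: measurable_qform => //; exact: mx_measurable_cst.
by have := mq measurableT [set true] I; rewrite setTI.
Qed.

Lemma mx_measurable_sym k (A : T -> 'M[R]_k) : (forall w, (A w)^T = A w) ->
  (forall v, measurable_fun setT (fun w => qform (A w) v)) -> mx_measurable A.
Proof.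
move=> sA mA i j.
have -> : (fun w => A w i j) = (fun w => 4^-1 *
    (qform (A w) (delta_mx i 0 + delta_mx j 0) -
     qform (A w) (delta_mx i 0 - delta_mx j 0))).
  by apply/funext => w; rewrite -polarization// mulKf.
by apply: measurable_funM => //; exact: measurable_funB.
Qed.

(** The variational formula bypasses the pseudoinverse: [c <= qform (Pi Q) x] is a countable
    intersection of conditions over rational controls, and polarization passes from forms to
    entries. *)
Lemma mx_measurable_Pi n m (Q : T -> 'M[R]_(n + m)) :
  (forall w, psd (Q w)) -> mx_measurable Q -> mx_measurable (fun w => Pi (Q w)).
Proof.
move=> pQ mQ; apply: mx_measurable_sym => [w|x]; first exact: (psd_Pi (pQ w)).1.
apply: (measurability _ (RGenCInfty.measurableE R)) => //.
move=> _ [_ [c ->] <-]; rewrite setTI.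
have -> : (fun w => qform (Pi (Q w)) x) @^-1` `[c, +oo[%classic =
    \bigcap_(q in [set: 'cV[rat]_m])
      [set w | c <= qform (Q w) (col_mx x (ratv q))].
  apply/seteqP; split => w /=.
    by rewrite in_itv /= andbT => h q _ /=; apply: le_trans h _; exact: Pi_le.
  by move=> h; rewrite in_itv /= andbT; apply: Pi_ge_ratv => // q; exact: h.
apply: countable_bigcap_measurable => q.
have mq : measurable_fun setT (fun w => c <= qform (Q w) (col_mx x (ratv q))).
  by apply: measurable_fun_ler => //; apply: measurable_qform => //; exact: mx_measurable_cst.
by have := mq measurableT [set true] I; rewrite setTI.
Qed.

End RationalVectors.

(** * Independence of the past *)

Section IndependentIntegral.
Context {R : realType}.

(** Factorisation on rectangles identifies the joint law of [f1] and [X] with a product measure;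
    Tonelli's theorem does the rest. [Y] enters only through its law, so it may live on another
    space. *)
Lemma ge0_integral_indep d (T : measurableType d) (P : probability T R)
  dF (TF : measurableType dF) e (S : measurableType e)
  d' (T' : measurableType d') (P' : probability T' R)
  (f1 : T -> TF) (X : T -> S) (Y : T' -> S) (f : TF * S -> \bar R) :
  measurable_fun setT f1 -> measurable_fun setT X -> measurable_fun setT Y ->
  (forall A B, measurable A -> measurable B ->
     P (f1 @^-1` A `&` X @^-1` B) = (P (f1 @^-1` A) * P' (Y @^-1` B))%E) ->
  measurable_fun setT f -> (forall z, (0 <= f z)%E) ->
  (\int[P]_w f (f1 w, X w) = \int[P]_w \int[P']_w' f (f1 w, Y w'))%E.
Proof.
move=> mf1 mX mY ind mf f0.
have mphi : measurable_fun setT (fun w => (f1 w, X w)) by exact: measurable_fun_pair.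
pose F1 : {mfun T >-> TF} := mfun_Sub (mem_set mf1).
pose Y1 : {mfun T' >-> S} := mfun_Sub (mem_set mY).
pose phi : {mfun T >-> (TF * S)%type} := mfun_Sub (mem_set mphi).
transitivity (\int[distribution P phi]_z f z)%E.
  by rewrite ge0_integral_distribution.
transitivity (\int[distribution P F1 \x distribution P' Y1]_z f z)%E.
  apply: eq_measure_integral => A mA _; apply/esym.
  apply: product_measure_unique => //.
rewrite fubini_tonelli1// ge0_integral_distribution//; last 2 first.
- exact: measurable_fun_fubini_tonelli_F.
- by move=> z; exact: integral_ge0.
apply: eq_integral => w _; rewrite /= /fubini_F ge0_integral_distribution//.
by apply: measurableT_comp => //; exact: pair1_measurable.
Qed.

End IndependentIntegral.

Section FiltrationIndependence.
Context {R : realType} {d : measure_display} {T : measurableType d}.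
Variables (P : probability T R) (n m : nat).
Variables (Lam : nat -> T -> 'M[R]_(n, n + m)) (N : nat -> T -> 'M[R]_(n + m)).
Hypothesis LamN_iid : iid P (fun t => as_pair (Lam t.+1) (N t.+1)).

Definition filtration_gen (t : nat) : set (set T) :=
  \bigcup_(s in [set s | (1 <= s <= t)%N])
    preimage_set_system setT (as_pair (Lam s) (N s)) measurable.

(** A copy of [T] carrying the sigma-algebra of time [t]: adaptedness becomes ordinary
    measurability, and product spaces with the past as a factor become available. *)
Definition filtered (t : nat) : Type := g_sigma_algebraType (filtration_gen t).

Lemma filtration_sub_measurable t : filtration Lam N t `<=` measurable.
Proof.
apply: smallest_sub; first exact: sigma_algebra_measurable.
move=> A [[//|s] _ [B mB <-]]; case: LamN_iid => mX _ _.
by apply: mX.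
Qed.

Lemma filtration_mono s t : (s <= t)%N -> filtration Lam N s `<=` filtration Lam N t.
Proof.
move=> st; apply: sub_smallest2r.
  exact: smallest_sigma_algebra.
move=> A [r /= /andP[r1 rs] rA]; exists r => //=.
by rewrite r1 (leq_trans rs).
Qed.

Lemma filtered_id t : measurable_fun setT (id : T -> filtered t).
Proof. by move=> _ A mA; rewrite setTI; exact: filtration_sub_measurable mA. Qed.

Lemma filtered_measurable t d' (U : measurableType d') (f : T -> U) :
  measurable_fun setT (f : filtered t -> U) -> measurable_fun setT f.
Proof.
move=> mf _ A mA; apply: (@filtration_sub_measurable t).
exact: (mf measurableT A mA).
Qed.

Lemma filtered_mono s t d' (U : measurableType d') (f : T -> U) : (s <= t)%N ->
  measurable_fun setT (f : filtered s -> U) ->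
  measurable_fun setT (f : filtered t -> U).
Proof.
move=> st mf _ A mA; apply: (filtration_mono st).
exact: (mf measurableT A mA).
Qed.

Lemma filtered_pair t :
  measurable_fun setT (as_pair (Lam t.+1) (N t.+1) : filtered t.+1 -> _).
Proof.
move=> _ A mA; apply: sub_sigma_algebra; exists t.+1 => /=; first by rewrite ltnSn.
by exists A.
Qed.

(** Dynkin's argument: as functions of [A], both sides are finite measures that agree on the
    cylinders over the first [t] pairs, a family stable under intersection that generates the
    past. *)
Lemma filtration_indep t A B : filtration Lam N t A -> measurable B ->
  P (A `&` as_pair (Lam t.+1) (N t.+1) @^-1` B) =
  (P A * P (as_pair (Lam t.+1) (N t.+1) @^-1` B))%E.
Proof.
move=> FA mB; have [mX ind _] := LamN_iid.
pose X s := as_pair (Lam s.+1) (N s.+1).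
pose H := [set A | exists2 B : nat -> set (mxborel R n (n + m) * mxborel R (n + m) (n + m)),
  forall s, measurable (B s) & A = \bigcap_(s in [set` iota 0 t]) X s @^-1` B s].
have mXB s C : measurable C -> measurable (X s @^-1` C).
  by move=> mC; rewrite -[_ @^-1` _]setTI; exact: mX.
have mC := mXB t B mB.
have HA : <<s H >> A.
  move: A FA; apply: smallest_sub; first exact: smallest_sigma_algebra.
  move=> A [[//|s] /= st [C mC' <-]]; apply: sub_sigma_algebra.
  exists (fun r => if r == s then C else setT) => [r|]; first by case: ifP.
  rewrite setTI; apply/seteqP; split => w /= h.
    by move=> r _ /=; case: eqP => [->|].
  by have := h s; rewrite /= eqxx; apply; rewrite mem_iota.
have mH : H `<=` measurable.
  move=> _ [C mC' ->]; apply: bigcap_measurableType => s _; exact: mXB.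
pose c := fine (P (X t @^-1` B)).
have c0 : 0 <= c by rewrite fine_ge0.
have Pc : P (X t @^-1` B) = c%:E by rewrite fineK// fin_num_measure.
rewrite -/(X t) Pc muleC.
have := @g_sigma_algebra_measure_unique _ R T H mH (fun=> setT) _ _
  (mrestr P mC) (mscale (NngNum c0) P) _ _ _ A HA; apply => //.
- move=> _; exists (fun=> setT) => //; apply/seteqP; split => // w _ r _ //.
- by rewrite bigcup_const.
- move=> _ _ [B1 mB1 ->] [B2 mB2 ->]; exists (fun s => B1 s `&` B2 s).
    by move=> s; exact: measurableI.
  by rewrite -bigcapI.
- move=> _ [C mC' ->]; rewrite /mrestr.
  set A0 := \bigcap_(_ in _) _.
  transitivity (P A0 * P (X t @^-1` B))%E; last by rewrite Pc muleC.
  rewrite {}/A0.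
  rewrite (ind (iota 0 t) C (iota_uniq _ _) mC').
  (* [X s] is the pair of time [s + 1], so the past uses the indices below [t] and the fresh pair
     takes slot [t], where [B] is inserted. *)
  pose C' s := if s == t then B else C s.
  have mC'' s : measurable (C' s) by rewrite /C'; case: ifP.
  have CE s : s \in iota 0 t -> C' s = C s.
    by rewrite mem_iota add0n /C' => /andP[_ st]; rewrite ltn_eqF.
  have := ind (iota 0 t.+1) C' (iota_uniq _ _) mC''.
  rewrite -addn1 iotaD add0n big_cat /= big_seq1 {3}/C' eqxx -/(X t).
  rewrite big_seq (eq_bigr (fun s => P (X s @^-1` C s))); last first.
    by move=> s /CE ->.
  rewrite -big_seq => <-; congr (P _); apply/seteqP; split => w /=.
    move=> [h Bw] s /=; rewrite mem_cat inE /C'; case: eqP => [->//|_].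
    by rewrite orbF; exact: h.
  move=> h; split => [s /= si|].
    by have := h s; rewrite /= mem_cat si /= CE//; exact.
  by have := h t; rewrite /= mem_cat inE eqxx orbT /C' eqxx; exact.
- by move=> k /=; rewrite (le_lt_trans _ (ltry 1))// /mrestr probability_le1//; exact: measurableI.
Qed.

End FiltrationIndependence.

(** * Averages of independent noise, the iterates and the control problem *)

Section SpectralNorm.
Context {R : realType}.

Lemma coord_le_enorm k (v : 'cV[R]_k) i : `|v i 0| <= enorm v.
Proof.
rewrite -sqrtr_sqr /enorm ler_sqrt; last by apply: sumr_ge0 => j _; exact: sqr_ge0.
by rewrite (bigD1 i)//= lerDl sumr_ge0// => j _; exact: sqr_ge0.
Qed.

Lemma enorm_le_sum k (v : 'cV[R]_k) : enorm v <= \sum_i `|v i 0|.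
Proof.
have s0 : 0 <= \sum_i `|v i 0| by apply: sumr_ge0.
rewrite -(ger0_norm s0) -sqrtr_sqr /enorm ler_sqrt ?sqr_ge0//.
rewrite expr2 mulr_suml; apply: ler_sum => i _.
rewrite -(real_normK (num_real (v i 0))) expr2 ler_wpM2l//.
by rewrite (bigD1 i)//= lerDl sumr_ge0.
Qed.

Lemma enorm_mulmx_le p (A : 'M[R]_p) v : enorm v <= 1 ->
  enorm (A *m v) <= entry_sum A.
Proof.
move=> v1; apply: le_trans (enorm_le_sum _) _; apply: ler_sum => i _.
rewrite mxE; apply: le_trans (ler_norm_sum _ _ _) _; apply: ler_sum => j _.
by rewrite normrM ler_piMr// (le_trans (coord_le_enorm _ _)).
Qed.

Lemma norm2_has_sup p (A : 'M[R]_p) :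
  has_sup [set enorm (A *m v) | v in [set v : 'cV[R]_p | enorm v <= 1]].
Proof.
split; last by exists (entry_sum A) => _ [v v1 <-]; exact: enorm_mulmx_le.
exists (enorm (A *m 0)); exists 0 => //=.
rewrite /enorm big1 ?sqrtr0// => i _; by rewrite mxE expr0n.
Qed.

(** Together with [entry_le_norm2], this allows boundedness in [norm2] to be tested on [entry_sum],
    which is visibly measurable. *)
Lemma norm2_le_entry_sum p (A : 'M[R]_p) : norm2 A <= entry_sum A.
Proof.
apply: ge_sup; first exact: (norm2_has_sup A).1.
by move=> _ [v v1 <-]; exact: enorm_mulmx_le.
Qed.

Lemma entry_le_norm2 p (A : 'M[R]_p) i j : `|A i j| <= norm2 A.
Proof.
have -> : A i j = (A *m (delta_mx j 0 : 'cV[R]_p)) i 0 by rewrite -colE mxE.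
apply: le_trans (coord_le_enorm _ _) _; apply: ub_le_sup.
  exact: (norm2_has_sup A).2.
exists (delta_mx j 0) => //=.
rewrite /enorm (bigD1 j)//= big1 => [|k kj]; rewrite !mxE ?eqxx ?expr1n ?addr0 ?sqrtr1//.
by rewrite (negbTE kj) expr0n.
Qed.

Lemma entry_sum_le k (A : 'M[R]_k) c : (forall i j, `|A i j| <= c) ->
  entry_sum A <= c *+ (k * k).
Proof.
move=> h; apply: le_trans (_ : _ <= \sum_(i < k) \sum_(j < k) c) _.
  by apply: ler_sum => i _; apply: ler_sum => j _.
by rewrite !sumr_const card_ord -mulrnA.
Qed.

End SpectralNorm.

Section DominatedWithoutMeasurability.
Context {R : realType} {d : measure_display} {T : measurableType d}.

(** The integral of a nonnegative function is a supremum over the simple functions below it, hence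
    monotone on arbitrary functions. This covers [norm2] of a random matrix, whose measurability is
    not established. *)
Lemma ge0_le_integral_dom (mu : {measure set T -> \bar R}) (f g : T -> \bar R) :
  (forall w, 0 <= f w)%E -> (forall w, f w <= g w)%E ->
  (\int[mu]_w f w <= \int[mu]_w g w)%E.
Proof.
move=> f0 fg; rewrite !ge0_integralTE//; last by move=> w; exact: le_trans (fg w).
apply: le_ereal_sup => _ [h hf <-]; exists h => // w.
exact: le_trans (hf w) (fg w).
Qed.

Lemma integrable_sqr (P : probability T R) (g : T -> R) :
  measurable_fun setT g -> (\int[P]_w (g w ^+ 2)%:E < +oo)%E ->
  P.-integrable setT (fun w => (g w)%:E) /\
  P.-integrable setT (fun w => (g w ^+ 2)%:E).
Proof.
move=> mg g2.
have i2 : P.-integrable setT (fun w => (g w ^+ 2)%:E).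
  apply/integrableP; split; first exact/measurable_EFinP/measurable_funX.
  by under eq_integral do rewrite gee0_abs ?lee_fin ?sqr_ge0//.
have i1 : P.-integrable setT (fun=> 1%:E) by exact: finite_measure_integrable_cst.
split=> //; apply: le_integrable (integrableD measurableT i1 i2) => //.
  exact/measurable_EFinP.
move=> w _; rewrite /= lee_fin [leRHS]ger0_norm ?addr_ge0 ?sqr_ge0//.
rewrite -(real_normK (num_real (g w))).
have := sqr_ge0 (`|g w| - 1); have := normr_ge0 (g w); rewrite sqrrB; lra.
Qed.

End DominatedWithoutMeasurability.

Section DrivingSequence.
Context {R : realType} {d : measure_display} {T : measurableType d}.
Variables (P : probability T R) (n m : nat).
Variables (Lam : nat -> T -> 'M[R]_(n, n + m)) (N : nat -> T -> 'M[R]_(n + m)).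
Hypothesis LamN_iid : iid P (fun t => as_pair (Lam t.+1) (N t.+1)).
Context {d' : measure_display} {T' : measurableType d'}.
Variables (P' : probability T' R).
Variables (L : T' -> 'M[R]_(n, n + m)) (M : T' -> 'M[R]_(n + m)).
Hypothesis LM_meas : measurable_fun setT (as_pair L M).
Hypothesis LM_copy : same_law P' P (as_pair L M) (as_pair (Lam 1%N) (N 1%N)).

Let S : measurableType _ := (mxborel R n (n + m) * mxborel R (n + m) (n + m))%type.
Let X (t : nat) : T -> S := as_pair (Lam t.+1) (N t.+1).
Let Y : T' -> S := as_pair L M.
Let F (t : nat) := filtered Lam N t.

(** Conditioning on the past in integrated form: the fresh pair is replaced by the copy [Y] and
    integrated with the past frozen. *)
Lemma integral_next t (f : F t * S -> \bar R) :
  measurable_fun setT f -> (forall z, 0 <= f z)%E ->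
  (\int[P]_w f (w, X t w) = \int[P]_w \int[P']_w' f (w, Y w'))%E.
Proof.
move=> mf f0; have [mX _ same] := LamN_iid.
apply: (ge0_integral_indep (f1 := id : T -> F t) _ (mX t) LM_meas _ mf f0).
  exact: (filtered_id LamN_iid (t := t)).
move=> A B mA mB; rewrite (filtration_indep LamN_iid mA mB) (same t B mB).
by rewrite (LM_copy mB).
Qed.

Definition adapted_real (a : nat -> T -> R) : Prop :=
  forall t, measurable_fun setT (a t : F t -> R).

(** * Martingale transforms of centred scalar noise *)

Section SquareIntegrableNoise.
Variables (h : S -> R) (v : R).
Hypothesis mh : measurable_fun setT h.
Hypothesis h_int : P'.-integrable setT (fun w => (h (Y w))%:E).
Hypothesis h_mean : (\int[P']_w (h (Y w))%:E = 0)%E.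
Hypothesis h2_int : P'.-integrable setT (fun w => (h (Y w) ^+ 2)%:E).
Hypothesis h2_mean : (\int[P']_w (h (Y w) ^+ 2)%:E = v%:E)%E.

Lemma noise_variance_ge0 : 0 <= v.
Proof. by rewrite -lee_fin -h2_mean integral_ge0// => w _; rewrite lee_fin sqr_ge0. Qed.

Lemma second_moment_noise (x a : R) :
  (\int[P']_w ((x + a * h (Y w)) ^+ 2)%:E = (x ^+ 2 + v * a ^+ 2)%:E)%E.
Proof.
have i1 : P'.-integrable setT (fun w => ((2 * x * a)%:E * (h (Y w))%:E)%E).
  exact: integrableZl.
have i2 : P'.-integrable setT (fun w => ((a ^+ 2)%:E * (h (Y w) ^+ 2)%:E)%E).
  exact: integrableZl.
have i0 : P'.-integrable setT (fun=> (x ^+ 2)%:E).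
  exact: finite_measure_integrable_cst.
transitivity (\int[P']_w ((x ^+ 2)%:E + ((2 * x * a)%:E * (h (Y w))%:E +
    (a ^+ 2)%:E * (h (Y w) ^+ 2)%:E)))%E.
  apply: eq_integral => w _; rewrite -!EFinM -!EFinD; congr EFin; ring.
rewrite integralD//; last exact: integrableD.
rewrite integralD// !integralZl// h_mean h2_mean mule0 add0e.
have -> : (\int[P']__ (x ^+ 2)%:E = (x ^+ 2)%:E)%E.
  by rewrite integral_cst// [X in (_ * X)%E](probability_setT P') mule1.
by rewrite -EFinM -EFinD mulrC.
Qed.

(** Orthogonality of a martingale increment. The square is nonnegative, so [integral_next] applies
    even when both sides are infinite. *)
Lemma second_moment_step t (x a : T -> R) :
  measurable_fun setT (x : F t -> R) -> measurable_fun setT (a : F t -> R) ->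
  (\int[P]_w ((x w + a w * h (X t w)) ^+ 2)%:E =
   \int[P]_w (x w ^+ 2)%:E + v%:E * \int[P]_w (a w ^+ 2)%:E)%E.
Proof.
move=> mx ma; have v0 := noise_variance_ge0.
have mx' := filtered_measurable LamN_iid mx.
have ma' := filtered_measurable LamN_iid ma.
pose f (z : F t * S) := ((x z.1 + a z.1 * h z.2) ^+ 2)%:E.
have mf : measurable_fun setT f.
  apply/measurable_EFinP/measurable_funX/measurable_funD.
    exact: (measurableT_comp mx (measurable_fst (T2 := S))).
  apply: measurable_funM.
    exact: (measurableT_comp ma (measurable_fst (T2 := S))).
  exact: (measurableT_comp mh (measurable_snd (T1 := F t))).
rewrite (integral_next mf) => [|z]; last by rewrite lee_fin sqr_ge0.
under eq_integral => w _ do rewrite /f /= second_moment_noise EFinD (EFinM v).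
have m2 (y : T -> R) : measurable_fun setT y ->
    measurable_fun setT (fun w => (y w ^+ 2)%:E).
  by move=> my; apply/measurable_EFinP/measurable_funX.
rewrite ge0_integralD//=; last 4 first.
- by move=> w _; rewrite lee_fin sqr_ge0.
- exact: m2.
- by move=> w _; rewrite -EFinM lee_fin mulr_ge0// sqr_ge0.
- by apply: measurable_funeM; exact: m2.
rewrite ge0_integralZl_EFin//; first by move=> w _; rewrite lee_fin sqr_ge0.
exact: m2.
Qed.

Definition transform (a : nat -> T -> R) t w : R := \sum_(0 <= s < t) a s w * h (X s w).

Section MaximalInequality.
Variables (a : nat -> T -> R) (eps : R).
Hypothesis a_adapted : adapted_real a.
Hypothesis eps_gt0 : 0 < eps.

(* [transform a] frozen as soon as it leaves ]-eps, eps[. *)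
Fixpoint stopped t w : R := if t is s.+1 then
  stopped s w + (if `|stopped s w| < eps then a s w else 0) * h (X s w) else 0.

Lemma filtered_noise t :
  measurable_fun setT ((fun w => h (X t w)) : F t.+1 -> R).
Proof.
exact: (measurableT_comp mh (filtered_pair (Lam := Lam) (N := N) (t := t))).
Qed.

Lemma filtered_stopped : adapted_real stopped.
Proof.
elim=> [|t IH] /=; first exact: measurable_cst.
apply: measurable_funD; first exact: (filtered_mono (leqnSn t) IH).
apply: measurable_funM; last exact: filtered_noise.
apply: (filtered_mono (leqnSn t)).
apply: measurable_fun_ifT; [|exact: a_adapted|exact: measurable_cst].
by apply: measurable_fun_ltr => //; apply: measurableT_comp => //; exact: IH.
Qed.

Lemma filtered_transform : adapted_real (transform a).
Proof.
move=> t; elim: t => [|t IH].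
  have -> : transform a 0 = fun=> 0 by apply/funext => w; rewrite /transform big_geq.
  exact: measurable_cst.
have -> : transform a t.+1 = fun w => transform a t w + a t w * h (X t w).
  by apply/funext => w; rewrite /transform big_nat_recr.
apply: measurable_funD; first exact: (filtered_mono (leqnSn t) IH).
apply: measurable_funM; last exact: filtered_noise.
by apply: (filtered_mono (leqnSn t)); exact: a_adapted.
Qed.

(** Freezing is irreversible, so a value still below [eps] certifies that the level was never
    crossed. *)
Lemma stoppedE t w : `|stopped t w| < eps -> stopped t w = transform a t w /\
  forall j, (j <= t)%N -> `|transform a j w| < eps.
Proof.
elim: t => [|t IH] /=.
  rewrite /transform normr0 big_geq// => _; split => // j; rewrite leqn0 => /eqP ->.
  by rewrite big_geq// normr0.
case: ifPn => [lt_eps st|]; last first.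
  by move=> /negP ge_eps; rewrite mul0r addr0 => /ge_eps.
have [sE IH'] := IH lt_eps.
have tE : stopped t w + a t w * h (X t w) = transform a t.+1 w.
  by rewrite sE /transform big_nat_recr.
split=> // j; rewrite leq_eqVlt => /predU1P[->|]; first by rewrite -tE.
by rewrite ltnS; exact: IH'.
Qed.

Lemma second_moment_stopped t :
  (\int[P]_w (stopped t w ^+ 2)%:E <=
   v%:E * \sum_(0 <= s < t) \int[P]_w (a s w ^+ 2)%:E)%E.
Proof.
have v0 := noise_variance_ge0.
elim: t => [|t IH] /=.
  by rewrite big_geq// mule0 expr0n /= integral0_eq.
rewrite (second_moment_step (filtered_stopped (t := t))); last first.
  apply: measurable_fun_ifT; [|exact: a_adapted|exact: measurable_cst].
  apply: measurable_fun_ltr => //; apply: measurableT_comp => //.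
  exact: filtered_stopped.
rewrite big_nat_recr//= [leRHS]ge0_muleDr; last 2 first.
- by apply: sume_ge0 => s _; apply: integral_ge0 => w _; rewrite lee_fin sqr_ge0.
- by apply: integral_ge0 => w _; rewrite lee_fin sqr_ge0.
apply: leeD => //; rewrite lee_wpmul2l ?lee_fin//; apply: ge0_le_integral => //.
- by move=> w _; rewrite lee_fin sqr_ge0.
- apply/measurable_EFinP/measurable_funX.
  apply: measurable_fun_ifT; last exact: measurable_cst.
    apply: measurable_fun_ltr => //; apply: measurableT_comp => //.
    exact: (filtered_measurable LamN_iid (filtered_stopped (t := t))).
  by apply: (filtered_measurable LamN_iid (t := t)); exact: a_adapted.
- apply/measurable_EFinP/measurable_funX.
  by apply: (filtered_measurable LamN_iid (t := t)); exact: a_adapted.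
- by move=> w _; case: ifP; rewrite lee_fin// expr0n sqr_ge0.
Qed.

Lemma measurable_transform_ge t :
  measurable [set w | exists2 j, (j <= t)%N & eps <= `|transform a j w|].
Proof.
have -> : [set w | exists2 j, (j <= t)%N & eps <= `|transform a j w|] =
    \bigcup_(j in [set j | (j <= t)%N]) [set w | eps <= `|transform a j w|].
  by apply/seteqP; split => w [j jt hj]; exists j.
apply: bigcup_measurable => j _.
have mq : measurable_fun setT (fun w => eps <= `|transform a j w|).
  apply: measurable_fun_ler => //; apply: measurableT_comp => //.
  exact: (filtered_measurable LamN_iid (filtered_transform (t := j))).
by have := mq measurableT [set true] I; rewrite setTI.
Qed.

(** Chebyshev's inequality for [stopped t], which is frozen at absolute value at least [eps] on the
    event in question. *)
Lemma maximal_inequality t :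
  ((eps ^+ 2)%:E * P [set w | exists2 j, (j <= t)%N & (eps <= `|transform a j w|)%R]
   <= v%:E * \sum_(0 <= s < t) \int[P]_w (a s w ^+ 2)%:E)%E.
Proof.
apply: le_trans (second_moment_stopped t).
set A := [set w | _]; have mA : measurable A by exact: measurable_transform_ge.
have ms : measurable_fun setT (fun w => (stopped t w ^+ 2)%:E).
  apply/measurable_EFinP/measurable_funX.
  exact: (filtered_measurable LamN_iid (filtered_stopped (t := t))).
have s0 w : (0 <= (stopped t w ^+ 2)%:E)%E by rewrite lee_fin sqr_ge0.
apply: (@le_trans _ _ (\int[P]_(w in A) (stopped t w ^+ 2)%:E)%E); last first.
  by apply: ge0_subset_integral.
rewrite -integral_cst//; apply: ge0_le_integral => //.
- by move=> w _; rewrite lee_fin sqr_ge0.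
- exact: measurable_funTS.
- move=> w [j jt jeps]; rewrite lee_fin -(real_normK (num_real (stopped t w))).
  rewrite lerXn2r ?nnegrE//; first exact: ltW.
  rewrite leNgt; apply/negP => /stoppedE[_ /(_ j jt)].
  by rewrite ltNge jeps.
Qed.

End MaximalInequality.

(** Small tails of the series of second moments make it unlikely that the transform ever moves by
    [e] after a late time, so almost every path is Cauchy. *)
Lemma transform_cvg (a : nat -> T -> R) C : adapted_real a ->
  (forall t w, \sum_(0 <= s < t) a s w ^+ 2 <= C) ->
  {ae P, forall w, cvgn (fun t => transform a t w)}.
Proof.
move=> ma aC; have v0 := noise_variance_ge0.
have ma' t : measurable_fun setT (a t) by exact: (filtered_measurable LamN_iid (ma t)).
have mint t : measurable_fun setT (fun w => (a t w ^+ 2)%:E).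
  exact/measurable_EFinP/measurable_funX.
have a2 t w : (0 <= (a t w ^+ 2)%:E)%E by rewrite lee_fin sqr_ge0.
pose I t := (\int[P]_w (a t w ^+ 2)%:E)%E.
have sI t : (\sum_(0 <= s < t) I s <= C%:E)%E.
  rewrite /I -ge0_integral_sum//.
  apply: (@le_trans _ _ (\int[P]_w C%:E)%E).
    apply: ge0_le_integral => //.
    - by move=> w _; apply: sume_ge0.
    - by apply: emeasurable_sum.
    - by move=> w _; rewrite sumEFin lee_fin.
  by rewrite integral_cst// [X in (_ * X)%E](probability_setT P) mule1.
have I0 t : (0 <= I t)%E by apply: integral_ge0.
have Ifin t : I t \is a fin_num.
  rewrite ge0_fin_numE//; apply: le_lt_trans (ltry C).
  apply: le_trans (sI t.+1); rewrite big_nat_recr//= leeDr//.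
  exact: sume_ge0.
pose r t := fine (I t).
have rI t : I t = (r t)%:E by rewrite fineK.
have r0 t : 0 <= r t by rewrite fine_ge0.
have rS t : \sum_(0 <= s < t) r s <= C.
  by rewrite -lee_fin -sumEFin; under eq_bigr do rewrite -rI; exact: sI.
have tail eta : 0 < eta -> exists t0, forall t, (t0 <= t)%N ->
    \sum_(t0 <= s < t) r s <= eta.
  move=> eta0; have : cvgn (fun t => \sum_(0 <= s < t) r s).
    apply: nondecreasing_is_cvgn; last by exists C => _ [t _ <-].
    by apply/nondecreasing_seqP => t; rewrite [leRHS]big_nat_recr//= lerDl.
  move=> /cvg_ex[l rl]; have eta20 : 0 < eta / 2 by rewrite divr_gt0.
  move/cvgrPdist_le : rl => /(_ _ eta20)[t0 _ ht0]; exists t0 => t tt.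
  have := ht0 t0 (leqnn _); have := ht0 t tt; rewrite /=.
  rewrite [X in `|_ - X| <= _ -> _](@big_cat_nat _ _ _ t0)//=.
  by rewrite !ler_norml => /andP[? ?] /andP[? ?]; lra.
(* Erasing the coefficients before [t0] turns the increment after [t0] into a transform, to which
   the maximal inequality applies. *)
pose b t0 s w := if (t0 <= s)%N then a s w else 0.
have mb t0 : adapted_real (b t0).
  by move=> s; rewrite /b; case: (t0 <= s)%N; [exact: ma | exact: measurable_cst].
have bE t0 t w : (t0 <= t)%N -> transform (b t0) t w = transform a t w - transform a t0 w.
  move=> tt; rewrite /transform !(@big_cat_nat _ _ _ t0 0 t)//=.
  rewrite [RHS]addrAC subrr add0r big1_seq ?add0r.
    by apply: eq_big_nat => s /andP[ts _]; rewrite /b ts.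
  by move=> s /= ; rewrite mem_index_iota /b (leqNgt t0) => /andP[_ ->]; rewrite mul0r.
pose B e t0 := [set w | exists j, e <= `|transform (b t0) j w|].
have mB e t0 : measurable (B e t0).
  have -> : B e t0 = \bigcup_t
      [set w | exists2 j, (j <= t)%N & e <= `|transform (b t0) j w|].
    by apply/seteqP; split => w [j]; [exists j => //; exists j|move=> _ [k _ ?]; exists k].
  by apply: bigcupT_measurable => t; exact: measurable_transform_ge.
have PB e t0 eta : 0 < e -> (forall t, (t0 <= t)%N -> \sum_(t0 <= s < t) r s <= eta) ->
    ((e ^+ 2)%:E * P (B e t0) <= (v * eta)%:E)%E.
  move=> e0 hr.
  have le_t t : ((e ^+ 2)%:E *
      P [set w | exists2 j, (j <= t)%N & (e <= `|transform (b t0) j w|)%R] <=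
      (v * eta)%:E)%E.
    apply: le_trans (maximal_inequality (mb t0) e0 t) _.
    rewrite EFinM lee_wpmul2l ?lee_fin//.
    have -> : (\sum_(0 <= s < t) \int[P]_w (b t0 s w ^+ 2)%:E)%E =
        (\sum_(0 <= s < t) (if (t0 <= s)%N then r s else 0))%:E.
      rewrite -sumEFin; apply: eq_bigr => s _; rewrite /b; case: ifP => _.
        exact: rI.
      by rewrite expr0n /= integral0_eq.
    rewrite lee_fin; have [tt|/ltnW tt] := leqP t0 t.
      rewrite (@big_cat_nat _ _ _ t0)//= big1_seq ?add0r.
        apply: le_trans (hr t tt); rewrite le_eqVlt; apply/orP; left; apply/eqP.
        by apply: eq_big_nat => s /andP[-> _].
      by move=> s /= ; rewrite mem_index_iota (leqNgt t0) => /andP[_ ->].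
    rewrite big1_seq; first by have := hr t0 (leqnn _); rewrite big_geq.
    move=> s /=; rewrite mem_index_iota => /andP[_ st].
    by rewrite leqNgt (leq_trans st tt).
  have -> : B e t0 = \bigcup_t
      [set w | exists2 j, (j <= t)%N & (e <= `|transform (b t0) j w|)%R].
    by apply/seteqP; split => w [j]; [exists j => //; exists j|move=> _ [k _ ?]; exists k].
  have e20 : 0 < e ^+ 2 by rewrite exprn_gt0.
  rewrite -lee_pdivlMl//.
  apply: (cvge_le _ (nondecreasing_cvg_mu _ _ _)).
  - by apply: nearW => t; rewrite /= lee_pdivlMl.
  - by move=> t; exact: measurable_transform_ge.
  - by apply: bigcupT_measurable => t; exact: measurable_transform_ge.
  - by move=> s t st; apply/subsetPset => w [j js ?]; exists j => //; exact: leq_trans st.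
have neg e : 0 < e -> P (\bigcap_t0 B e t0) = 0%E.
  move=> e0; apply/eqP; rewrite eq_le measure_ge0 andbT.
  have e20 : 0 < e ^+ 2 by rewrite exprn_gt0.
  apply/lee_addgt0Pr => x x0; rewrite add0e.
  (* A tail below this value makes the probability at most [x]; [v + 1] allows for vanishing
     variance. *)
  have eta0 : 0 < x * e ^+ 2 / (v + 1) by rewrite divr_gt0 ?mulr_gt0//; lra.
  have [t0 ht0] := tail _ eta0; have := PB e t0 _ e0 ht0.
  rewrite -lee_pdivlMl// => PBx.
  apply: (@le_trans _ _ (P (B e t0))).
    apply: le_measure; rewrite ?inE//; first exact: bigcapT_measurable.
    by move=> w; apply.
  apply: (le_trans PBx); rewrite -EFinM lee_fin ler_pdivrMl//.
  have -> : v * (x * e ^+ 2 / (v + 1)) = (v / (v + 1)) * (x * e ^+ 2) by ring.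
  rewrite [leRHS]mulrC -[leRHS]mul1r ler_wpM2r ?mulr_ge0 ?sqr_ge0// 1?ltW//.
  by rewrite ltr_pdivrMr; lra.
have : {ae P, forall w, forall k, ~ (\bigcap_t0 B k.+1%:R^-1 t0) w}.
  apply/ae_foralln => k; exists (\bigcap_t0 B k.+1%:R^-1 t0); split.
  - exact: bigcapT_measurable.
  - by apply: neg; rewrite invr_gt0.
  - by move=> w /= /contrapT.
apply: filterS => w hw; apply/cauchy_cvgP/cauchy_exP => e e0.
have [k _ hk] := near_infty_natSinv_lt (PosNum e0).
have := hw k; rewrite -existsNP => -[t0]; rewrite not_implyE => -[_ nB].
exists (transform a t0 w); exists t0 => // t /= tt.
rewrite /ball /= distrC ltNge; apply/negP => le_e; apply: nB; exists t.
rewrite bE//; apply: le_trans le_e; apply/ltW; exact: (hk k (leqnn _)).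
Qed.

Variable alpha : nat -> T -> R.
Hypothesis alpha01 : forall t w, 0 <= alpha t w <= 1.
Hypothesis alpha_adapted : adapted_real alpha.
Hypothesis alpha_sum : {ae P, forall w, (\sum_(0 <= t <oo) (alpha t w)%:E = +oo)%E}.
Hypothesis alpha_sum2 :
  {ae P, forall w, (\sum_(0 <= t <oo) (alpha t w ^+ 2)%:E < +oo)%E}.

(** Localisation: the sum of squared rates is finite almost surely but need not be bounded
    uniformly. [a k] is switched off once that sum exceeds [k], a cut known at time [t] since
    [A t.+1] involves rates up to [t] only; on almost every path some [k] never cuts. *)
Lemma noise_average_cvg0 (c : nat -> T -> R) b : adapted_real c ->
  (forall t w, `|c t w| <= b) ->
  {ae P, forall w, average (alpha ^~ w) (fun t => c t w * h (X t w)) @ \oo --> 0}.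
Proof.
move=> mc cb.
pose A t w := \sum_(0 <= s < t) alpha s w ^+ 2.
have AS t w : A t.+1 w = A t w + alpha t w ^+ 2 by rewrite /A big_nat_recr.
pose a (k : nat) t w := if A t.+1 w <= k%:R then alpha t w * c t w else 0.
have mA s t : (t <= s.+1)%N -> measurable_fun setT (A t : F s -> R).
  elim: t => [|t IH] ts.
    have -> : A 0%N = fun=> 0 by apply/funext => w; rewrite /A big_geq.
    exact: measurable_cst.
  have -> : A t.+1 = fun w => A t w + alpha t w ^+ 2 by apply/funext => w.
  apply: measurable_funD; first by apply: IH; exact: ltnW.
  have mal : measurable_fun setT (alpha t : F s -> R).
    by apply: (filtered_mono (s := t) (t := s)) => //; exact: alpha_adapted.
  exact: measurable_funX.
have ma k : adapted_real (a k).
  move=> t; apply: measurable_fun_ifT; last exact: measurable_cst.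
    by apply: measurable_fun_ler => //; exact: mA.
  by apply: measurable_funM; [exact: alpha_adapted | exact: mc].
have ab k t w : \sum_(0 <= s < t) a k s w ^+ 2 <= b ^+ 2 * k%:R.
  have b0 : 0 <= b by apply: le_trans (cb 0%N w).
  (* Both bounds are carried through the induction: while [A t.+1 <= k], the second follows from the
     first. *)
  suff /andP[_ h1] : (\sum_(0 <= s < t) a k s w ^+ 2 <= b ^+ 2 * A t w) &&
      (\sum_(0 <= s < t) a k s w ^+ 2 <= b ^+ 2 * k%:R) by [].
  elim: t => [|t /andP[IH1 IH2]].
    by rewrite big_geq// /A big_geq// mulr0 lexx mulr_ge0// sqr_ge0.
  rewrite big_nat_recr//= AS /a; case: ifPn => [le_k|_]; last first.
    rewrite expr0n addr0 IH2 andbT; apply: le_trans IH1 _.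
    by rewrite ler_wpM2l ?sqr_ge0// lerDl sqr_ge0.
  have cb2 : (alpha t w * c t w) ^+ 2 <= b ^+ 2 * alpha t w ^+ 2.
    rewrite exprMn mulrC ler_wpM2r ?sqr_ge0//.
    by rewrite -(real_normK (num_real (c t w))) lerXn2r ?nnegrE.
  have le1 : \sum_(0 <= s < t) a k s w ^+ 2 + (alpha t w * c t w) ^+ 2 <=
    b ^+ 2 * (A t w + alpha t w ^+ 2) by rewrite mulrDr lerD.
  by rewrite le1 (le_trans le1)// ler_wpM2l ?sqr_ge0// -AS.
have /ae_foralln : forall k, {ae P, forall w, cvgn (fun t => transform (a k) t w)}.
  by move=> k; apply: transform_cvg (ma k) (ab k).
move: alpha_sum alpha_sum2; apply: filterS3 => w sum1 sum2 cv.
apply: (average_cvg0 (fun t => alpha01 t w) sum1).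
pose l := fine (\sum_(0 <= t <oo) (alpha t w ^+ 2)%:E)%E.
have al0 t : (0 <= (alpha t w ^+ 2)%:E)%E by rewrite lee_fin sqr_ge0.
have Al t : A t w <= l.
  rewrite -lee_fin fineK; last first.
    by rewrite ge0_fin_numE//; apply: nneseries_ge0.
  by rewrite /A -sumEFin; apply: nneseries_lim_ge.
have [k _ lk] := nbhs_infty_ger l.
suff -> : (fun t => \sum_(0 <= s < t) alpha s w * (c s w * h (X s w))) =
    (fun t => transform (a k) t w) by exact: cv.
apply/funext => t; apply: eq_bigr => s _.
by rewrite /a (le_trans (Al s.+1) (lk k (leqnn k))) mulrA.
Qed.

End SquareIntegrableNoise.

Hypothesis M_psd : forall w, psd (M w).
Hypothesis moment2 : (\int[P']_w
  (norm2 (M w) ^+ 2 + norm2 ((L w)^T *m L w) ^+ 2)%:E < +oo)%E.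

Lemma measurable_M : mx_measurable M.
Proof.
apply: mxborel_mx_measurable.
exact: (measurableT_comp (measurable_snd (T1 := mxborel R n (n + m))) LM_meas).
Qed.

Lemma measurable_L : mx_measurable L.
Proof.
apply: mxborel_mx_measurable.
exact: (measurableT_comp
  (measurable_fst (T2 := mxborel R (n + m) (n + m))) LM_meas).
Qed.

Lemma sqr_integral_lty (g : T' -> R) : measurable_fun setT g ->
  (forall w, `|g w| <= norm2 (M w) \/ `|g w| <= norm2 ((L w)^T *m L w)) ->
  (\int[P']_w (g w ^+ 2)%:E < +oo)%E.
Proof.
move=> mg gb; apply: le_lt_trans moment2; apply: ge0_le_integral_dom => w.
  by rewrite lee_fin sqr_ge0.
rewrite lee_fin -(real_normK (num_real (g w))); case: (gb w) => h.
  by apply: ler_wpDr; rewrite ?sqr_ge0// lerXn2r ?nnegrE// (le_trans _ h).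
by apply: ler_wpDl; rewrite ?sqr_ge0// lerXn2r ?nnegrE// (le_trans _ h).
Qed.

Lemma sqr_integral_M i j : (\int[P']_w (M w i j ^+ 2)%:E < +oo)%E.
Proof.
apply: sqr_integral_lty => [|w]; first exact: measurable_M.
by left; exact: entry_le_norm2.
Qed.

(** The squares in column [s] of [A] add up to a diagonal entry of [A^T *m A], and products are
    dominated by squares. The moment assumption thus covers all products of two entries of [L]. *)
Lemma LTL_entry_le (A : 'M[R]_(n, n + m)) k l i j :
  `|A k i * A l j| <= norm2 (A^T *m A).
Proof.
have diag r s : A r s ^+ 2 <= norm2 (A^T *m A).
  apply: le_trans (le_trans (ler_norm _) (entry_le_norm2 _ s s)).
  rewrite mxE (bigD1 r)//= mxE -expr2 lerDl sumr_ge0// => q _.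
  by rewrite mxE -expr2 sqr_ge0.
have := diag k i; have := diag l j; rewrite ler_norml.
have := sqr_ge0 (A k i - A l j); have := sqr_ge0 (A k i + A l j).
by rewrite sqrrD sqrrB !mulr2n => *; apply/andP; split; lra.
Qed.

Lemma sqr_integral_L k l i j :
  (\int[P']_w ((L w k i * L w l j) ^+ 2)%:E < +oo)%E.
Proof.
apply: sqr_integral_lty => [|w]; last by right; exact: LTL_entry_le.
by apply: measurable_funM; exact: measurable_L.
Qed.

Lemma integrable_M i j : P'.-integrable setT (fun w => (M w i j)%:E).
Proof. exact: (integrable_sqr (measurable_M i j) (sqr_integral_M i j)).1. Qed.

Lemma integrable_L k l i j :
  P'.-integrable setT (fun w => (L w k i * L w l j)%:E).
Proof.
apply: (integrable_sqr _ (sqr_integral_L k l i j)).1.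
by apply: measurable_funM; exact: measurable_L.
Qed.

Lemma conj_entry (A : 'M[R]_(n, n + m)) (K : 'M[R]_n) i j :
  (A^T *m K *m A) i j = \sum_(kl : 'I_n * 'I_n) K kl.1 kl.2 * (A kl.1 i * A kl.2 j).
Proof.
rewrite mxE -(pair_bigA _ (fun k l => K k l * (A k i * A l j))) exchange_big /=.
apply: eq_bigr => l _; rewrite mxE mulr_suml; apply: eq_bigr => k _.
by rewrite mxE; ring.
Qed.

(** Each entry is an explicit affine function of [K]; this yields [Ebackup_affine] and the centring
    of the noise below. *)
Lemma Ebackup_entry K i j : Ebackup P' L M K i j = \int[P']_w M w i j +
  \sum_(kl : 'I_n * 'I_n) K kl.1 kl.2 * \int[P']_w (L w kl.1 i * L w kl.2 j).
Proof.
rewrite mxE; have intK (kl : 'I_n * 'I_n) : P'.-integrable setT (EFin \o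
    (fun w => K kl.1 kl.2 * (L w kl.1 i * L w kl.2 j))).
  exact: (integrableZl measurableT (K kl.1 kl.2) (integrable_L kl.1 kl.2 i j)).
rewrite (eq_Rintegral _ _ (g := fun w => M w i j +
  \sum_(kl : 'I_n * 'I_n) K kl.1 kl.2 * (L w kl.1 i * L w kl.2 j))); last first.
  by move=> w _; rewrite mxE conj_entry.
rewrite RintegralD//; [|exact: integrable_M|].
  congr (_ + _); rewrite /Rintegral; under eq_integral do rewrite -sumEFin.
  rewrite integral_sum//.
  rewrite -sum_fine => [|kl _]; last by apply: integrable_fin_num => //; exact: intK.
  by apply: eq_bigr => kl _; rewrite -[LHS]/(Rintegral P' setT
    (fun w => K kl.1 kl.2 * (L w kl.1 i * L w kl.2 j))) RintegralZl//; exact: integrable_L.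
rewrite [X in integrable _ _ X](_ : _ = fun w => \sum_(kl : 'I_n * 'I_n)
    (K kl.1 kl.2 * (L w kl.1 i * L w kl.2 j))%:E)%E; last first.
  by apply/funext => w /=; rewrite sumEFin.
by apply: integrable_sum => // kl _; exact: intK.
Qed.

Lemma Ebackup_affine s K : Ebackup P' L M (s *: K) =
  s *: Ebackup P' L M K + (1 - s) *: mxexp P' M.
Proof.
apply/matrixP => i j; rewrite [RHS]mxE [X in _ = X + _]mxE [X in _ = _ + X]mxE.
rewrite !Ebackup_entry [mxexp _ _ _ _]mxE.
have -> : \sum_(kl : 'I_n * 'I_n) (s *: K) kl.1 kl.2 *
    \int[P']_w (L w kl.1 i * L w kl.2 j) =
  s * \sum_(kl : 'I_n * 'I_n) K kl.1 kl.2 * \int[P']_w (L w kl.1 i * L w kl.2 j).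
  by rewrite mulr_sumr; apply: eq_bigr => kl _; rewrite mxE mulrA.
by ring.
Qed.

Lemma backup_integrable K i j :
  P'.-integrable setT (fun w => ((M w + (L w)^T *m K *m L w) i j)%:E).
Proof.
rewrite (_ : (fun w => _) = fun w => ((M w i j)%:E + \sum_(kl : 'I_n * 'I_n)
    ((K kl.1 kl.2)%:E * (L w kl.1 i * L w kl.2 j)%:E))%E).
  apply: integrableD => //; first exact: integrable_M.
  by apply: integrable_sum => // kl _; apply: integrableZl => //; exact: integrable_L.
by apply/funext => w; rewrite mxE conj_entry EFinD -sumEFin.
Qed.

Lemma qform_Ebackup K v : (\int[P']_w (qform (M w + (L w)^T *m K *m L w) v)%:E =
  (qform (Ebackup P' L M K) v)%:E)%E.
Proof.
pose B w := M w + (L w)^T *m K *m L w.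
transitivity (\int[P']_w \sum_(ij : 'I_(n + m) * 'I_(n + m))
    ((v ij.1 0 * v ij.2 0)%:E * (B w ij.1 ij.2)%:E))%E.
  apply: eq_integral => w _.
  rewrite qformE (pair_bigA _ (fun i j => B w i j * (v i 0 * v j 0))) sumEFin.
  by congr EFin; apply: eq_bigr => ij _; rewrite mulrC.
have iB (ij : 'I_(n + m) * 'I_(n + m)) :
    P'.-integrable setT (fun w => ((v ij.1 0 * v ij.2 0)%:E * (B w ij.1 ij.2)%:E)%E).
  by apply: integrableZl => //; exact: backup_integrable.
rewrite integral_sum// qformE.
rewrite (pair_bigA _ (fun i j => Ebackup P' L M K i j * (v i 0 * v j 0))) -sumEFin.
apply: eq_bigr => ij _ /=; rewrite integralZl//; last exact: backup_integrable.
rewrite [RHS]EFinM muleC; congr (_ * _)%E.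
rewrite [Ebackup _ _ _ _ _ _]mxE /Rintegral fineK//; apply: integrable_fin_num => //.
exact: backup_integrable.
Qed.

Lemma psd_Ebackup K : psd K -> psd (Ebackup P' L M K).
Proof.
move=> pK; have pB w : psd (M w + (L w)^T *m K *m L w) by apply/psdD/psd_conj.
split=> [|v].
  apply/matrixP => i j; rewrite !mxE; apply: eq_Rintegral => w _.
  by rewrite -[in RHS](pB w).1 [RHS]mxE.
rewrite -lee_fin -qform_Ebackup; apply: integral_ge0 => w _.
by rewrite lee_fin (pB w).2.
Qed.

Lemma Ebackup_mono K K' : psd K -> psd K' -> mle K K' ->
  mle (Ebackup P' L M K) (Ebackup P' L M K').
Proof.
move=> pK pK' KK v.
suff : (\int[P']_w (qform (M w + (L w)^T *m K *m L w) v)%:E <=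
    \int[P']_w (qform (M w + (L w)^T *m K' *m L w) v)%:E)%E.
  by rewrite (qform_Ebackup K) (qform_Ebackup K') lee_fin.
apply: ge0_le_integral_dom => w; rewrite lee_fin.
  exact: (psdD (M_psd w) (psd_conj _ pK)).2.
by rewrite !qformD !qform_conj lerD2l.
Qed.

Variable alpha : nat -> T -> R.
Hypothesis alpha01 : forall t w, 0 <= alpha t w <= 1.
Hypothesis alpha_adapted : adapted_real alpha.
Hypothesis alpha_sum : {ae P, forall w, (\sum_(0 <= t <oo) (alpha t w)%:E = +oo)%E}.
Hypothesis alpha_sum2 :
  {ae P, forall w, (\sum_(0 <= t <oo) (alpha t w ^+ 2)%:E < +oo)%E}.

Lemma centered_average_cvg0 (g : S -> R) (c : nat -> T -> R) b :
  measurable_fun setT g -> (\int[P']_w (g (Y w) ^+ 2)%:E < +oo)%E ->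
  adapted_real c -> (forall t w, `|c t w| <= b) ->
  {ae P, forall w, average (alpha ^~ w)
    (fun t => c t w * (g (X t w) - \int[P']_w (g (Y w)))) @ \oo --> 0}.
Proof.
move=> mg g2 mc cb; pose e := \int[P']_w (g (Y w)).
have mgY : measurable_fun setT (fun w => g (Y w)) by exact: (measurableT_comp mg LM_meas).
have [ig ig2] := integrable_sqr mgY g2.
have eE : (\int[P']_w (g (Y w))%:E = e%:E)%E.
  by rewrite /e /Rintegral fineK//; exact: integrable_fin_num.
have ie : P'.-integrable setT (fun=> e%:E) by exact: finite_measure_integrable_cst.
have ih : P'.-integrable setT (fun w => (g (Y w) - e)%:E).
  by under eq_fun do rewrite EFinB; exact: integrableB.
have ih2 : P'.-integrable setT (fun w => ((g (Y w) - e) ^+ 2)%:E).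
  apply: (integrable_sqr _ _).2; first exact: measurable_funB.
  have le w : (((g (Y w) - e) ^+ 2)%:E <= (2 * g (Y w) ^+ 2 + 2 * e ^+ 2)%:E)%E.
    by rewrite lee_fin; have := sqr_ge0 (g (Y w) + e); rewrite sqrrD sqrrB !mulr2n; lra.
  apply: (@le_lt_trans _ _ (\int[P']_w (2 * g (Y w) ^+ 2 + 2 * e ^+ 2)%:E)%E).
    by apply: ge0_le_integral_dom => // w; rewrite lee_fin sqr_ge0.
  apply: integrable_lty => //.
  under eq_fun do rewrite EFinD EFinM.
  apply: integrableD => //; first exact: integrableZl.
  exact: finite_measure_integrable_cst.
have he : (\int[P']_w (g (Y w) - e)%:E = 0)%E.
  under eq_integral do rewrite EFinB; rewrite integralB// eE.
  by rewrite integral_cst// [X in (_ * X)%E](probability_setT P') mule1 subee.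
have := @noise_average_cvg0 (fun s => g s - e) (fine (\int[P']_w ((g (Y w) - e) ^+ 2)%:E)%E).
apply => //; first exact: measurable_funB.
by rewrite fineK//; exact: integrable_fin_num.
Qed.

(** The matrix noise is a finite sum of centred scalars, coming from [N_ij] and
    [Lambda_ki Lambda_lj], with predictable coefficients [g] and [g * C k l]. Only these
    coefficients are assumed bounded, so [C] may grow as [g] shrinks. *)
Lemma backup_noise_average (g : nat -> T -> R) (C : nat -> T -> 'M[R]_n) b :
  adapted_real g -> (forall k l, adapted_real (fun t w => g t w * C t w k l)) ->
  (forall t w, `|g t w| <= b) -> (forall t w k l, `|g t w * C t w k l| <= b) ->
  {ae P, forall w, mcvg (mx_average (alpha ^~ w) (fun t => g t w *:
    (N t.+1 w + (Lam t.+1 w)^T *m C t w *m Lam t.+1 w -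
     Ebackup P' L M (C t w)))) 0}.
Proof.
move=> mg mC gb Cb.
have mS2 : mx_measurable (snd : S -> 'M[R]_(n + m)).
  apply: mxborel_mx_measurable.
  exact: (measurable_snd (T1 := mxborel R n (n + m))).
have mS1 : mx_measurable (fst : S -> 'M[R]_(n, n + m)).
  apply: mxborel_mx_measurable.
  exact: (measurable_fst (T2 := mxborel R (n + m) (n + m))).
have hN i j := @centered_average_cvg0 (fun s => (s.2 : 'M[R]_(n + m)) i j) g b
  (mS2 i j) (sqr_integral_M i j) mg gb.
have hL i j (kl : 'I_n * 'I_n) := @centered_average_cvg0
  (fun s => (s.1 : 'M[R]_(n, n + m)) kl.1 i * (s.1 : 'M[R]_(n, n + m)) kl.2 j)
  (fun t w => g t w * C t w kl.1 kl.2) b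
  (measurable_funM (mS1 kl.1 i) (mS1 kl.2 j)) (sqr_integral_L kl.1 kl.2 i j)
  (mC kl.1 kl.2) (fun t w => Cb t w kl.1 kl.2).
have ff : Filter (almost_everywhere P) by exact: ae_filter_ringOfSetsType.
have {}hN := filter_forall ff (fun i => filter_forall ff (hN i)).
have {}hL := filter_forall ff (fun i => filter_forall ff (fun j =>
  filter_forall ff (hL i j))).
move: hN hL; apply: filterS2 => w hN hL i j; rewrite [X in _ --> X]mxE.
have -> : (fun t => mx_average (alpha^~ w) (fun t => g t w *:
    (N t.+1 w + (Lam t.+1 w)^T *m C t w *m Lam t.+1 w -
     Ebackup P' L M (C t w))) t i j) = fun t =>
  average (alpha^~ w) (fun t => g t w * (N t.+1 w i j - \int[P']_w M w i j)) t +
  \sum_(kl : 'I_n * 'I_n) average (alpha^~ w) (fun t => g t w * C t w kl.1 kl.2 *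
    (Lam t.+1 w kl.1 i * Lam t.+1 w kl.2 j -
     \int[P']_w (L w kl.1 i * L w kl.2 j))) t.
  apply/funext => t; rewrite mx_averageE -average_sum -averageD.
  congr (average _ _ t); apply/funext => s.
  have E3 (A B D : 'M[R]_(n + m)) : (A + B - D) i j = A i j + B i j - D i j.
    by rewrite !mxE.
  rewrite mxE E3 conj_entry Ebackup_entry.
  set x := fun kl : 'I_n * 'I_n => Lam s.+1 w kl.1 i * Lam s.+1 w kl.2 j.
  set y := fun kl : 'I_n * 'I_n => \int[P']_w (L w kl.1 i * L w kl.2 j).
  have -> : \sum_kl g s w * C s w kl.1 kl.2 * (x kl - y kl) =
    g s w * (\sum_kl C s w kl.1 kl.2 * x kl) - g s w * (\sum_kl C s w kl.1 kl.2 * y kl).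
    by rewrite !mulr_sumr -sumrB; apply: eq_bigr => kl _; ring.
  by ring.
rewrite -[X in _ --> X]addr0; apply: cvgD; first exact: hN.
rewrite [X in _ --> X](_ : 0 = \sum_(kl : 'I_n * 'I_n) 0); last by rewrite big1.
by apply: cvg_sumr => kl; exact: hL.
Qed.

(** * The Q-learning iterates *)

Hypothesis N_psd : forall t w, psd (N t.+1 w).
Hypothesis EM_posdef : posdef (mxexp P' M).
Variable Q0 : 'M[R]_(n + m).
Hypothesis Q0_psd : psd Q0.

Let Q := Qseq Lam N alpha Q0.
Let FE := Ebackup P' L M.

Let FE_affine s K : 0 <= s -> psd K -> FE (s *: K) = s *: FE K + (1 - s) *: mxexp P' M.
Proof. by move=> _ _; exact: Ebackup_affine. Qed.

Lemma Qseq_rec t w : Q t.+1 w = (1 - alpha t w) *: Q t w +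
  alpha t w *: (N t.+1 w + (Lam t.+1 w)^T *m Pi (Q t w) *m Lam t.+1 w).
Proof.
rewrite /Q /= -/(Q t w); move: (Q t w) (Pi _) => A B.
by rewrite scalerBr scalerBl scale1r addrA addrAC.
Qed.

Lemma psd_Qseq t w : psd (Q t w).
Proof.
elim: t => [|t IH]; first exact: Q0_psd.
have /andP[a0 a1] := alpha01 t w; rewrite Qseq_rec; apply: psdD.
  by apply: psdZ => //; rewrite subr_ge0.
by apply: psdZ => //; apply: psdD => //; apply: psd_conj; exact: psd_Pi.
Qed.

Lemma filtered_mx_measurable s t p q (A : T -> 'M[R]_(p, q)) : (s <= t)%N ->
  mx_measurable (A : F s -> 'M[R]_(p, q)) -> mx_measurable (A : F t -> 'M[R]_(p, q)).
Proof. by move=> st mA i j; apply: (filtered_mono st); exact: mA. Qed.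

Lemma filtered_mx_measurableT t p q (A : T -> 'M[R]_(p, q)) :
  mx_measurable (A : F t -> 'M[R]_(p, q)) -> mx_measurable A.
Proof. by move=> mA i j; apply: (filtered_measurable LamN_iid (t := t)); exact: mA. Qed.

Lemma filtered_N t : mx_measurable (N t.+1 : F t.+1 -> 'M[R]_(n + m)).
Proof.
apply: mxborel_mx_measurable.
exact: (measurableT_comp (measurable_snd (T1 := mxborel R n (n + m)))
  (filtered_pair (Lam := Lam) (N := N) (t := t))).
Qed.

Lemma filtered_Lam t : mx_measurable (Lam t.+1 : F t.+1 -> 'M[R]_(n, n + m)).
Proof.
apply: mxborel_mx_measurable.
exact: (measurableT_comp (measurable_fst (T2 := mxborel R (n + m) (n + m)))
  (filtered_pair (Lam := Lam) (N := N) (t := t))).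
Qed.

Lemma filtered_Qseq t : mx_measurable (Q t : F t -> 'M[R]_(n + m)).
Proof.
elim: t => [|t IH]; first exact: mx_measurable_cst.
have mQ := filtered_mx_measurable (leqnSn t) IH.
have mal : measurable_fun setT (alpha t : F t.+1 -> R).
  by apply: (filtered_mono (leqnSn t)); exact: alpha_adapted.
rewrite (_ : Q t.+1 = fun w => (1 - alpha t w) *: Q t w + alpha t w *:
    (N t.+1 w + (Lam t.+1 w)^T *m Pi (Q t w) *m Lam t.+1 w)); last first.
  by apply/funext => w; rewrite Qseq_rec.
apply: mx_measurableD; apply: mx_measurableZ => //; first exact: measurable_funB.
apply: mx_measurableD; first exact: filtered_N.
apply: mx_measurableM; last exact: filtered_Lam.
apply: mx_measurableM; first by apply: mx_measurable_tr; exact: filtered_Lam.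
by apply: mx_measurable_Pi => // w; exact: psd_Qseq.
Qed.

Lemma value_iter_noise : {ae P, forall w k, mcvg (mx_average (alpha ^~ w)
  (backup_noise FE (fun t => N t.+1 w) (fun t => Lam t.+1 w) (value_iter FE k))) 0}.
Proof.
apply/ae_foralln => k; set K := value_iter FE k.
have h1 : adapted_real (fun _ _ => 1) by move=> t; exact: measurable_cst.
have h2 i j : adapted_real (fun _ _ => 1 * K i j) by move=> t; exact: measurable_cst.
have h3 i j : `|1 * K i j| <= 1 + entry_sum K.
  rewrite mul1r ler_wpDl// /entry_sum (bigD1 i)//= (bigD1 j)//= -addrA lerDl.
  by rewrite addr_ge0 ?sumr_ge0// => *; rewrite sumr_ge0.
have h4 : `|1| <= 1 + entry_sum K by rewrite normr1 lerDl entry_sum_ge0.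
have := backup_noise_average (C := fun _ _ => K) h1 h2 (fun _ _ => h4) (fun _ _ => h3).
apply: filterS => w; congr (mcvg (mx_average _ _) _).
by apply/funext => t; rewrite scale1r.
Qed.

Section Convergence.
Variables (K : 'M[R]_n) (C dd : R).
Hypothesis K_psd : psd K.
Hypothesis K_sol : K = Pi (FE K).
Hypothesis dd01 : 0 < dd < 1.
Hypothesis C_ge0 : 0 <= C.
Hypothesis C_dom : forall A, mle A ((C * entry_sum A) *: FE K).

(** Realises the running scale [g] of the pathwise argument. By [C_dom] the value taken at a reset
    dominates [Q] in the gauge of [FE K], and the summand 2 gives the required lower bound. *)
Fixpoint scale t w : R := if t is s.+1 then
    if `[< mle (Q s.+1 w) (((1 + dd / 2) * scale s w) *: FE K) >] then scale s w
    else 2 + C * entry_sum (Q s.+1 w)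
  else 2 + C * entry_sum Q0.

Lemma scale_ge2 t w : 2 <= scale t w.
Proof.
have h A : 2 <= 2 + C * entry_sum A :> R.
  by rewrite lerDl mulr_ge0 ?entry_sum_ge0.
by elim: t => [|t IH] //=; case: ifP.
Qed.

Let FEK_ge0 v : 0 <= qform (FE K) v.
Proof. exact: (psd_Ebackup K_psd).2. Qed.

Lemma Qseq_le_scale t w : mle (Q t w) (((1 + dd / 2) * scale t w) *: FE K).
Proof.
have /andP[d0 d1] := dd01.
have h A : mle A (((1 + dd / 2) * (2 + C * entry_sum A)) *: FE K).
  apply: mle_trans (C_dom A) _ => v; rewrite !qformZ ler_wpM2r//.
  have := mulr_ge0 C_ge0 (entry_sum_ge0 A); nra.
case: t => [|t]; first exact: (h Q0).
rewrite [scale t.+1 w]/=.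
by case: ifPn => [/asboolP //|_]; exact: h.
Qed.

Lemma scale_reset t w :
  ~ mle (Q t.+1 w) (((1 + dd / 2) * scale t w) *: FE K) ->
  mle (Q t.+1 w) (scale t.+1 w *: FE K).
Proof.
move=> no; rewrite [scale t.+1 w]/= asboolF//.
apply: mle_trans (C_dom _) _ => v; rewrite !qformZ ler_wpM2r//.
by rewrite lerDr.
Qed.

Lemma adapted_scale : adapted_real scale.
Proof.
have h t : measurable_fun setT ((fun w => 2 + C * entry_sum (Q t w)) : F t -> R).
  apply: measurable_funD => //; apply: measurable_funM => //.
  by apply: measurable_entry_sum; exact: filtered_Qseq.
elim=> [|t IH]; first exact: (h 0%N).
have IH' := filtered_mono (leqnSn t) IH.
apply: measurable_fun_ifT => //.
apply: (measurable_fun_bool true); rewrite setTI.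
rewrite (_ : _ @^-1` _ = [set w : F t.+1 | mle (Q t.+1 w)
    (((1 + dd / 2) * scale t w) *: FE K)]); last first.
  by apply/seteqP; split => w /asboolP.
apply: measurable_mle; first exact: filtered_Qseq.
apply: mx_measurableZ; last exact: mx_measurable_cst.
exact: measurable_funM.
Qed.

(** From [Q t <= s FE K] with [s = (1 + dd / 2) scale], the Riccati equation gives
    [Pi (Q t) <= s K]. After division by the scale, the entries of [Pi (Q t)] are therefore bounded
    in terms of [K] alone. *)
Lemma scaled_noise : {ae P, forall w, mcvg (mx_average (alpha ^~ w)
  (fun t => (scale t w)^-1 *: backup_noise FE (fun t => N t.+1 w)
     (fun t => Lam t.+1 w) (Pi (Q t w)) t)) 0}.
Proof.
have /andP[d0 d1] := dd01.
have si t w : 0 < (scale t w)^-1 <= 1.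
  have s2 := scale_ge2 t w; rewrite invr_gt0 invf_le1; first by apply/andP; split; lra.
  by lra.
have h1 : adapted_real (fun t w => (scale t w)^-1).
  (* The scale is positive, so its inverse is a real power and measurability of [powR] applies. *)
  move=> t; have -> : (fun w => (scale t w)^-1) = (fun w => scale t w `^ (-1)).
    by apply/funext => w; rewrite powR_inv1//; have := scale_ge2 t w; lra.
  exact: (measurableT_comp (measurable_powR (-1)) (adapted_scale (t := t))).
have h2 k l : adapted_real (fun t w => (scale t w)^-1 * Pi (Q t w) k l).
  move=> t; apply: measurable_funM; first exact: h1.
  by apply: mx_measurable_Pi => [w|]; [exact: psd_Qseq|exact: filtered_Qseq].
have b0 := entry_sum_ge0 K.
apply: (backup_noise_average (b := 1 + 4 * entry_sum K)) => // [t w|t w k l].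
  have /andP[s0 s1] := si t w; rewrite gtr0_norm//; lra.
have Kd i : K i i <= entry_sum K.
  apply: le_trans (ler_norm _) _; rewrite /entry_sum (bigD1 i)//= (bigD1 i)//=.
  rewrite -addrA lerDl.
  by rewrite addr_ge0 ?sumr_ge0// => *; rewrite sumr_ge0.
have /andP[s0 s1] := si t w; have s2 := scale_ge2 t w.
set s := (1 + dd / 2) * scale t w.
have ss : 0 <= s by rewrite mulr_ge0//; lra.
have PK : mle (Pi (Q t w)) (s *: K).
  rewrite [K in s *: K]K_sol.
  apply: mle_trans (Pi_mono (psd_Qseq t w) (psdZ ss (psd_Ebackup K_psd)) _) _.
    exact: Qseq_le_scale.
  by apply: PiZ_le => //; exact: psd_Ebackup.
have := psd_entry_le k l (psd_Pi (psd_Qseq t w)) PK.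
rewrite normrM gtr0_norm// !mxE => h.
rewrite mulrC ler_pdivrMr; last by lra.
apply: le_trans h _; rewrite -mulrDr /s.
have := Kd k; have := Kd l => ? ?.
have : K k k + K l l <= 2 * entry_sum K by lra.
have : 0 <= K k k + K l l.
  by rewrite -!bform_delta addr_ge0//; exact: K_psd.2.
set x := K k k + K l l; set z := entry_sum K => x0 xz.
have : (1 + dd / 2) * x <= 2 * (2 * z) by nra.
move=> /(ler_wpM2l (_ : 0 <= scale t w)); nra.
Qed.

End Convergence.

Lemma Qseq_cvg K : psd K -> K = Pi (FE K) -> {ae P, forall w, mcvg (Q ^~ w) (FE K)}.
Proof.
move=> pK eK.
have [dd dd01 dE] := posdef_rate (FE K) EM_posdef.
have pW := posdef_F EM_posdef psd_Ebackup Ebackup_mono FE_affine pK.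
have [C C0 CW] := posdef_dominates pW.
move: (scaled_noise pK eK dd01 C0 CW) value_iter_noise alpha_sum.
apply: filterS3 => w sn vn asum.
apply: (@iteration_cvg _ _ _ FE _ EM_posdef psd_Ebackup Ebackup_mono FE_affine
  (alpha ^~ w) (fun t => alpha01 t w) asum (fun t => N t.+1 w) (Q ^~ w)
  (fun t => Lam t.+1 w) (fun t => N_psd t w) (fun t => psd_Qseq t w)
  (fun t => Qseq_rec t w) K dd (fun t => scale K C dd t w)) => //.
- by move=> t; exact: scale_ge2.
- by move=> t h; rewrite /= asboolT.
- by move=> t; exact: scale_reset.
Qed.

Definition bounded_paths : set T := [set w |
  (ereal_sup [set (norm2 (Q t w))%:E | t in [set: nat]] < +oo)%E].

Lemma bounded_pathsP w : bounded_paths w <->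
  exists c : nat, forall t, entry_sum (Q t w) <= c%:R.
Proof.
split=> [|[c hc]]; last first.
  apply: (@le_lt_trans _ _ (c%:R)%:E); last exact: ltry.
  apply: ge_ereal_sup => _ [t _ <-]; rewrite lee_fin.
  exact: le_trans (norm2_le_entry_sum _) (hc t).
rewrite /bounded_paths /=; set s := ereal_sup _ => s_lt.
have ub t : ((norm2 (Q t w))%:E <= s)%E by apply: ereal_sup_ubound; exists t.
have s_fin : s \is a fin_num.
  rewrite fin_numElt s_lt andbT; apply: lt_le_trans (ub 0%N).
  exact: ltNyr.
have [c _ hc] := nbhs_infty_ger (fine s *+ ((n + m) * (n + m))).
exists c => t; apply: le_trans (hc c (leqnn c)); apply: entry_sum_le => i j.
apply: le_trans (entry_le_norm2 _ _ _) _.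
by rewrite -lee_fin fineK.
Qed.

Lemma measurable_bounded_paths : measurable bounded_paths.
Proof.
have -> : bounded_paths = \bigcup_c \bigcap_t [set w | entry_sum (Q t w) <= c%:R].
  apply/seteqP; split => w; first by move=> /bounded_pathsP[c hc]; exists c => // t _; exact: hc.
  by move=> [c _ hc]; apply/bounded_pathsP; exists c => t; exact: hc.
apply: bigcupT_measurable => c; apply: bigcapT_measurable => t.
have mq : measurable_fun setT (fun w => entry_sum (Q t w) <= c%:R).
  apply: measurable_fun_ler => //; apply: measurable_entry_sum.
  exact: (filtered_mx_measurableT (filtered_Qseq (t := t))).
by have := mq measurableT [set true] I; rewrite setTI.
Qed.

Lemma mcvg_bounded_paths (B : 'M[R]_(n + m)) w : mcvg (Q ^~ w) B -> bounded_paths w.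
Proof.
move=> QB; apply/bounded_pathsP.
have : mcvg (fun t => Q t w - B) 0.
  by rewrite -(subrr B); apply: mcvgB => //; exact: mcvg_cst.
move=> /cvg_entry_sum /cvgr_le /(_ 1 ltr01)[t0 _ ht0].
have es0 t : 0 <= entry_sum (Q t w) by exact: entry_sum_ge0.
have s0 : 0 <= \sum_(s < t0) entry_sum (Q s w) by apply: sumr_ge0.
have [k _ hk] := nbhs_infty_ger (1 + entry_sum B + \sum_(s < t0) entry_sum (Q s w)).
exists k => t; apply: le_trans (hk k (leqnn k)); have [tt|tt] := leqP t0 t.
  apply: (@le_trans _ _ (entry_sum (Q t w - B) + entry_sum B)).
    rewrite -big_split; apply: ler_sum => i _; rewrite -big_split; apply: ler_sum => j _.
    by rewrite !mxE /=; apply: le_trans (ler_normD _ _); rewrite subrK.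
  by have := ht0 t tt; lra.
rewrite (bigD1 (Ordinal tt))//= ler_wpDl ?addr_ge0 ?entry_sum_ge0//.
by rewrite lerDl sumr_ge0.
Qed.

(** Value iteration is deterministic, so one bounded path with vanishing noise averages suffices:
    there half of [FE K_k] lies below some [Q t], hence below a multiple of [E[N]] that does not
    depend on [k]. *)
Lemma bounded_paths_solvable : (0 < P bounded_paths)%E ->
  exists K, psd K /\ K = Pi (FE K).
Proof.
move=> Ppos.
have [w [[c hc] vn asum]] : exists w, [/\ exists c : nat, forall t, entry_sum (Q t w) <= c%:R,
    forall k, mcvg (mx_average (alpha ^~ w)
      (backup_noise FE (fun t => N t.+1 w) (fun t => Lam t.+1 w) (value_iter FE k))) 0
    & (\sum_(0 <= t <oo) (alpha t w)%:E = +oo)%E].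
  apply: contrapT => no; suff P0 : P bounded_paths = 0%E by rewrite P0 ltxx in Ppos.
  apply/(negligibleP _ measurable_bounded_paths).
  have : {ae P, forall w, ~ bounded_paths w}.
    move: value_iter_noise alpha_sum; apply: filterS2 => w vn asum /bounded_pathsP hw.
    by apply: no; exists w.
  by apply: negligibleS => w /= h1 h2.
have [C C0 CE] := posdef_dominates EM_posdef.
have Qle t : mle (Q t w) ((C * c%:R) *: mxexp P' M).
  apply: mle_trans (CE _) _ => v; rewrite !qformZ ler_wpM2r//.
    exact: (posdef_psd EM_posdef).2.
  by rewrite ler_wpM2l.
have Fle k : mle (FE (value_iter FE k)) ((2 * (C * c%:R)) *: mxexp P' M).
  have h : 0 < (1 / 2 : R) < 1 by apply/andP; split; lra.
  have := @lower_bound _ _ _ FE _ EM_posdef psd_Ebackup Ebackup_mono FE_affine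
    (alpha ^~ w) (fun t => alpha01 t w) asum (fun t => N t.+1 w) (Q ^~ w)
    (fun t => Lam t.+1 w) (fun t => N_psd t w) (fun t => psd_Qseq t w)
    (fun t => Qseq_rec t w) vn k _ h.
  move=> /filter_ex[t ht] v; have := ht v; have := Qle t v; rewrite !qformZ; lra.
have [v|K [pK eK _]] := value_iter_cvg EM_posdef psd_Ebackup Ebackup_mono FE_affine.
  (* The control 0 is a competitor in [Pi (FE K_k)]. *)
  exists (2 * (C * c%:R) * qform (mxexp P' M) (col_mx v 0)) => -[|k].
    rewrite qform0 mulr_ge0//; first by rewrite mulr_ge0// mulr_ge0.
    exact: (posdef_psd EM_posdef).2.
  rewrite -qformZ; apply: le_trans (Fle k _); apply: Pi_le.
  exact/psd_Ebackup/(psd_value_iter psd_Ebackup).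
by exists K.
Qed.

(** * The control problem: costs of arbitrary controls and of the feedback *)

Section ControlProblem.
Variable x0 : 'cV[R]_n.

Let pair_state u t w : 'cV[R]_(n + m) := col_mx (state Lam x0 u t w) (u t w).

Lemma filtered_state (u : nat -> T -> 'cV[R]_m) :
  (forall t, mx_measurable (u t : F t -> 'cV[R]_m)) ->
  forall t, mx_measurable (state Lam x0 u t : F t -> 'cV[R]_n).
Proof.
move=> mu; elim=> [|t IH] /=; first exact: mx_measurable_cst.
apply: mx_measurableM; first exact: filtered_Lam.
by apply: mx_measurable_col; apply: (filtered_mx_measurable (leqnSn t)).
Qed.

Lemma admissible_mx_measurable (u : nat -> T -> 'cV[R]_m) :
  admissible Lam N u -> forall t, mx_measurable (u t : F t -> 'cV[R]_m).
Proof.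
move=> au t; apply: mxborel_mx_measurable => _ B mB; rewrite setTI.
exact: au.
Qed.

Section Control.
Variable u : nat -> T -> 'cV[R]_m.
Hypothesis mu : forall t, mx_measurable (u t : F t -> 'cV[R]_m).

Let stage_cost t := (\int[P]_w (qform (N t.+1 w) (pair_state u t w))%:E)%E.

Lemma filtered_pair_state t : mx_measurable (pair_state u t : F t -> 'cV[R]_(n + m)).
Proof. by apply: mx_measurable_col => //; exact: filtered_state. Qed.

Lemma measurable_stage t :
  measurable_fun setT (fun w => (qform (N t.+1 w) (pair_state u t w))%:E).
Proof.
apply/measurable_EFinP/measurable_qform.
  exact: (filtered_mx_measurableT (filtered_N (t := t))).
exact: (filtered_mx_measurableT (filtered_pair_state (t := t))).
Qed.

(** One step of dynamic programming in expectation: conditioning on the past turns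
    [N + Lambda^T K Lambda] into [FE K]. *)
Lemma stage_cost_step K t : psd K ->
  (stage_cost t + \int[P]_w (qform K (state Lam x0 u t.+1 w))%:E =
   \int[P]_w (qform (FE K) (pair_state u t w))%:E)%E.
Proof.
move=> pK; rewrite /stage_cost -ge0_integralD//=; last 4 first.
- by move=> w _; rewrite lee_fin (N_psd t w).2.
- exact: measurable_stage.
- by move=> w _; rewrite lee_fin pK.2.
- apply/measurable_EFinP/measurable_qform; first exact: mx_measurable_cst.
  exact: (filtered_mx_measurableT (filtered_state mu (t := t.+1))).
(* The absolute value makes [f] nonnegative off the semidefinite matrices too. *)
pose f (z : F t * S) := (`|qform ((z.2.2 : 'M[R]_(n + m)) +
  (z.2.1 : 'M[R]_(n, n + m))^T *m K *m z.2.1) (pair_state u t z.1)|)%:E.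
have mf : measurable_fun setT f.
  apply/measurable_EFinP; apply: measurableT_comp => //.
  have m22 : mx_measurable (fun z : F t * S => z.2.2 : 'M[R]_(n + m)).
    apply: mxborel_mx_measurable; apply: measurableT_comp; first exact: measurable_snd.
    exact: measurable_snd.
  have m21 : mx_measurable (fun z : F t * S => z.2.1 : 'M[R]_(n, n + m)).
    apply: mxborel_mx_measurable; apply: measurableT_comp; first exact: measurable_fst.
    exact: measurable_snd.
  apply: measurable_qform.
    apply: mx_measurableD => //; apply: mx_measurableM => //.
    apply: mx_measurableM; last exact: mx_measurable_cst.
    exact: mx_measurable_tr.
  move=> i j; have := filtered_pair_state (t := t) i j => mp.
  exact: (measurableT_comp mp (measurable_fst (T2 := S))).
have f0 z : (0 <= f z)%E by rewrite lee_fin.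
transitivity (\int[P]_w f (w, X t w))%E.
  apply: eq_integral => w _; rewrite /f /=.
  rewrite ger0_norm; last exact: (psdD (N_psd t w) (psd_conj _ pK)).2.
  by rewrite qformD qform_conj.
rewrite (integral_next mf f0); apply: eq_integral => w _.
rewrite -(qform_Ebackup K); apply: eq_integral => w' _; rewrite /f /= ger0_norm//.
exact: (psdD (M_psd w') (psd_conj _ pK)).2.
Qed.

Lemma integral_cost : (\int[P]_w cost Lam N x0 u w = \sum_(0 <= t <oo) stage_cost t)%E.
Proof.
rewrite /cost integral_nneseries// => t; first exact: measurable_stage.
by move=> w _; rewrite lee_fin (N_psd t w).2.
Qed.

Lemma stage_cost_ge0 t : (0 <= stage_cost t)%E.
Proof. by apply: integral_ge0 => w _; rewrite lee_fin (N_psd t w).2. Qed.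

(** [value_iter FE k] acts as the optimal cost over [k] stages: by [Pi_le], the actual control does
    no better than the minimiser at any stage. *)
Lemma value_iter_le_stages k t :
  (\int[P]_w (qform (value_iter FE k) (state Lam x0 u t w))%:E <=
   \sum_(t <= s < t + k) stage_cost s)%E.
Proof.
elim: k t => [|k IH] t.
  rewrite addn0 big_geq// (_ : (fun w => _) = cst 0%E) ?integral0//.
  by apply/funext => w; rewrite qform0.
rewrite addnS big_ltn ?ltnS ?leq_addr//.
apply: (@le_trans _ _ (stage_cost t +
    \int[P]_w (qform (value_iter FE k) (state Lam x0 u t.+1 w))%:E)%E); last first.
  by rewrite leeD2l// -addSn.
have pk := psd_value_iter psd_Ebackup k.
rewrite stage_cost_step//; apply: ge0_le_integral_dom => w; rewrite lee_fin.
  exact: (psd_value_iter psd_Ebackup k.+1).2.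
exact: (Pi_le _ _ (psd_Ebackup pk)).
Qed.

Lemma value_iter_le_cost k :
  ((qform (value_iter FE k) x0)%:E <= \int[P]_w cost Lam N x0 u w)%E.
Proof.
rewrite integral_cost; apply: le_trans (nneseries_lim_ge k _).
  have := value_iter_le_stages k 0; rewrite add0n /= => h; apply: le_trans h.
  by rewrite integral_cst// [X in (_ * X)%E](probability_setT P) mule1.
by move=> t _ _; exact: stage_cost_ge0.
Qed.

End Control.

(** A feedback depends on the state, while [state] takes the control as an argument; building the
    trajectory first breaks this circularity. *)
Fixpoint closed_loop (G : 'M[R]_(m, n)) t w : 'cV[R]_n :=
  if t is s.+1 then
    Lam s.+1 w *m col_mx (closed_loop G s w) (G *m closed_loop G s w)
  else x0.

Lemma state_closed_loop G t w :
  state Lam x0 (fun t w => G *m closed_loop G t w) t w = closed_loop G t w.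
Proof. by elim: t => [|t IH] //=; rewrite IH. Qed.

Lemma filtered_closed_loop G t : mx_measurable (closed_loop G t : F t -> 'cV[R]_n).
Proof.
elim: t => [|t IH] /=; first exact: mx_measurable_cst.
apply: mx_measurableM; first exact: filtered_Lam.
apply: (filtered_mx_measurable (leqnSn t)); apply: mx_measurable_col => //.
by apply: mx_measurableM => //; exact: mx_measurable_cst.
Qed.

(** For the minimising control dynamic programming is an equality, so the cost so far plus
    [E[x_t^T K x_t]] stays equal to [qform K x0]. The remainder is dropped by sign; equality comes
    later from the lower bound on all costs. *)
Lemma feedback_cost K : psd K -> K = Pi (FE K) ->
  let u t w := Gamma (FE K) *m closed_loop (Gamma (FE K)) t w in
  admissible Lam N u /\ (\int[P]_w cost Lam N x0 u w <= (qform K x0)%:E)%E.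
Proof.
move=> pK eK u.
have mu t : mx_measurable (u t : F t -> 'cV[R]_m).
  by apply: mx_measurableM; [exact: mx_measurable_cst | exact: filtered_closed_loop].
split=> [t B mB|].
  have := mx_measurable_mxborel (mu t); move=> /(_ measurableT B mB).
  by rewrite setTI.
rewrite (integral_cost mu).
pose c t := (\int[P]_w (qform (N t.+1 w) (pair_state u t w))%:E)%E.
have c0 t : (0 <= c t)%E by exact: stage_cost_ge0.
have key t : (\sum_(0 <= s < t) c s +
    \int[P]_w (qform K (state Lam x0 u t w))%:E = (qform K x0)%:E)%E.
  elim: t => [|t IH].
    rewrite big_geq// add0e /= integral_cst//.
    by rewrite [X in (_ * X)%E](probability_setT P) mule1.
  rewrite big_nat_recr//= -addeA (stage_cost_step mu t pK) -[RHS]IH; congr (_ + _)%E.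
  apply: eq_integral => w _; congr EFin; rewrite [in RHS]eK -Pi_Gamma; last exact: psd_Ebackup.
  have sE : state Lam x0 u t w = closed_loop (Gamma (FE K)) t w.
    exact: state_closed_loop.
  by rewrite /pair_state sE.
apply: lime_le; first by apply: is_cvg_nneseries => t _ _; exact: c0.
apply: nearW => t; rewrite -(key t) leeDl//.
by apply: integral_ge0 => w _; rewrite lee_fin pK.2.
Qed.

End ControlProblem.

(** The lower bound is the limit of [value_iter_le_cost]; uniqueness identifies the limit of value
    iteration with the given [K]. *)
Lemma value_solution K : psd K -> K = Pi (FE K) ->
  forall x, value P Lam N x = (qform K x)%:E.
Proof.
move=> pK eK x; apply/eqP; rewrite eq_le; apply/andP; split.
  have [au le] := feedback_cost x pK eK.
  by apply: le_trans le; apply: ereal_inf_lbound; eexists; first exact: au.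
apply: le_ereal_inf_tmp => _ [u au <-].
have mu := admissible_mx_measurable au.
have [v|K' [pK' eK' cK']] := value_iter_cvg EM_posdef psd_Ebackup Ebackup_mono FE_affine.
  by exists (qform K v) => k; exact: (value_iter_le_sol psd_Ebackup Ebackup_mono).
have {eK' pK'}KK : K' = K.
  exact: (sol_unique EM_posdef psd_Ebackup Ebackup_mono FE_affine pK' eK' pK eK).
rewrite {}KK in cK'.
have [->|] := eqVneq (\int[P]_w cost Lam N x u w)%E +oo%E; first by rewrite leey.
rewrite -ltey => clt; have c0 : (0 <= \int[P]_w cost Lam N x u w)%E.
  rewrite (integral_cost x mu); apply: nneseries_ge0 => t _ _; exact: stage_cost_ge0.
have cf : (\int[P]_w cost Lam N x u w)%E \is a fin_num by rewrite ge0_fin_numE.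
rewrite -(fineK cf) lee_fin; apply: cvgr_to_le (cvg_qform (v := x) cK') _.
by apply: nearW => k; rewrite -lee_fin fineK// value_iter_le_cost.
Qed.

(** For each vector, a single control of finite cost bounds all value iterates there. *)
Lemma well_posed_solvable : (forall x, (value P Lam N x < +oo)%E) ->
  exists K, psd K /\ K = Pi (FE K).
Proof.
move=> wp.
have [v|K [pK eK _]] := value_iter_cvg EM_posdef psd_Ebackup Ebackup_mono FE_affine;
  last by exists K.
have [_ [u au <-] clt] := ereal_inf_lt (wp v).
exists (fine (\int[P]_w cost Lam N v u w)%E) => k.
have h j := value_iter_le_cost v (admissible_mx_measurable au) j.
rewrite -lee_fin fineK//; rewrite ge0_fin_numE//; apply: le_trans (h 0%N).
by rewrite lee_fin qform0.
Qed.

End DrivingSequence.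

Section MatrixConvergence.
Context {R : realType}.

Lemma mcvgP p q (A : nat -> 'M[R]_(p, q)) (B : 'M[R]_(p, q)) :
  mcvg A B <-> A @ \oo --> B.
Proof.
split=> AB.
  apply/cvg_ballP => e e0.
  have : \forall t \near \oo, forall i j, ball (B i j) e (A t i j).
    apply: filter_forall => i; apply: filter_forall => j.
    by move/cvg_ballP : (AB i j); exact.
  by apply: filterS => t h; split=> // i j; exact: h.
move=> i j; apply/cvg_ballP => e e0.
by move/cvg_ballP : AB => /(_ e e0); apply: filterS => t [_]; exact.
Qed.

End MatrixConvergence.

Theorem theorem1p1 (R : realType) (n m : nat) (n_ge1 : (1 <= n)%N)
  (m_ge1 : (1 <= m)%N)
  (* the driving sequence (Lambda_t, N_t), t >= 1 *)
  (d : measure_display) (T : measurableType d) (P : probability T R)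
  (Lam : nat -> T -> 'M[R]_(n, n + m)) (N : nat -> T -> 'M[R]_(n + m))
  (N_psd : forall t w, (1 <= t)%N -> psd (N t w))
  (LamN_iid : iid P (fun t => as_pair (Lam t.+1) (N t.+1)))
  (* the generic copy (Lambda, N), living on a space of its own *)
  (d' : measure_display) (T' : measurableType d') (P' : probability T' R)
  (L : T' -> 'M[R]_(n, n + m)) (M : T' -> 'M[R]_(n + m))
  (M_psd : forall w, psd (M w))
  (LM_meas : measurable_fun setT (as_pair L M))
  (LM_copy : same_law P' P (as_pair L M) (as_pair (Lam 1%N) (N 1%N)))
  (* moment and nondegeneracy assumptions *)
  (moment2 : (\int[P']_w
     (norm2 (M w) ^+ 2 + norm2 ((L w)^T *m L w) ^+ 2)%:E < +oo)%E)
  (EN_posdef : posdef (mxexp P' M))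
  (* learning rates and initial matrix *)
  (alpha : nat -> T -> R)
  (alpha01 : forall t w, 0 <= alpha t w <= 1)
  (alpha_adapted : adapted (filtration Lam N) alpha)
  (alpha_sum : {ae P, forall w, (\sum_(0 <= t <oo) (alpha t w)%:E = +oo)%E})
  (alpha_sum2 : {ae P, forall w,
     (\sum_(0 <= t <oo) (alpha t w ^+ 2)%:E < +oo)%E})
  (Q0 : 'M[R]_(n + m)) (Q0_psd : psd Q0) :
  let Q := Qseq Lam N alpha Q0 in
  let V := value P Lam N in
  let converges_to (Qstar : 'M[R]_(n + m)) :=
    psd Qstar /\ {ae P, forall w, (fun t => Q t w) @ \oo --> Qstar} in
  let well_posed : Prop := forall x, (V x < +oo)%E in
  let are_solvable : Prop := exists K, ARE_solution P' L M K in
  let bounded_pos : Prop := (0 < P [set w |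
    (ereal_sup [set (norm2 (Q t w))%:E | t in [set: nat]] < +oo)%E])%E in
  let as_convergent : Prop := exists Qstar, converges_to Qstar in
  [/\ well_posed <-> are_solvable, are_solvable <-> bounded_pos
    & bounded_pos <-> as_convergent] /\
  (well_posed \/ are_solvable \/ bounded_pos \/ as_convergent ->
   exists Qstar K,
     [/\ converges_to Qstar,
         forall x, V x = (qform K x)%:E,
         unique (ARE_solution P' L M) K /\ K = Pi Qstar,
         forall x, exists ustar,
           [/\ admissible Lam N ustar,
               forall t w, ustar t w = Gamma Qstar *m state Lam x ustar t w
             & (\int[P]_w cost Lam N x ustar w)%E = V x]
       & Qstar = mxexp P' (fun w => M w + (L w)^T *m Pi Qstar *m L w)]).

Proof.
have NP t w : psd (N t.+1 w) by exact: N_psd.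
have al_ad : adapted_real Lam N alpha.
  by move=> t _ B mB; rewrite setTI; exact: alpha_adapted.
move=> Q V converges_to well_posed are_solvable bounded_pos as_convergent.
pose FE := Ebackup P' L M.
have cvg_of K : ARE_solution P' L M K -> converges_to (FE K).
  move=> [pK eK]; split; first exact: (psd_Ebackup LM_meas M_psd moment2 pK).
  have := Qseq_cvg LamN_iid LM_meas LM_copy M_psd moment2 alpha01 al_ad alpha_sum
    alpha_sum2 NP EN_posdef Q0_psd pK eK.
  by apply: filterS => w /mcvgP.
have val_of K : ARE_solution P' L M K -> forall x, V x = (qform K x)%:E.
  move=> [pK eK]; exact: (value_solution LamN_iid LM_meas LM_copy M_psd moment2 NP EN_posdef pK eK).
have ab : well_posed -> are_solvable.
  exact: (well_posed_solvable LamN_iid LM_meas LM_copy M_psd moment2 NP EN_posdef).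
have ba : are_solvable -> well_posed.
  by move=> [K hK] x; rewrite (val_of K hK) ltry.
have bd : are_solvable -> as_convergent by move=> [K hK]; exists (FE K); exact: cvg_of.
have mB := measurable_bounded_paths LamN_iid alpha01 al_ad NP Q0_psd.
(* Convergent paths are bounded, so the event has probability 1; its measurability permits passing
   to the complement. *)
have dc : as_convergent -> bounded_pos.
  move=> [Qs [_ cv]].
  have : {ae P, forall w, bounded_paths Lam N alpha Q0 w}.
    by apply: filterS cv => w /mcvgP; exact: mcvg_bounded_paths.
  move=> nB; suff P1 : P (bounded_paths Lam N alpha Q0) = 1%E.
    by rewrite /bounded_pos -/(bounded_paths Lam N alpha Q0) P1 lte01.
  have : P (~` bounded_paths Lam N alpha Q0) = 0%E.
    by apply/(negligibleP _ (measurableC mB)).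
  by move=> PC; rewrite -[X in P X]setCK probability_setC ?PC ?sube0//; exact: measurableC.
have cb : bounded_pos -> are_solvable.
  exact: (bounded_paths_solvable LamN_iid LM_meas LM_copy M_psd moment2 alpha01 al_ad
    alpha_sum alpha_sum2 NP EN_posdef Q0_psd).
split; first by split; split; tauto.
move=> any; have [K hK] : are_solvable by tauto.
have [pK eK] := hK.
exists (FE K), K; split.
- exact: cvg_of.
- exact: val_of.
- split=> //; split=> // K' [pK' eK'].
  exact: (sol_unique EN_posdef (psd_Ebackup LM_meas M_psd moment2)
    (Ebackup_mono LM_meas M_psd moment2)
    (fun s K _ _ => Ebackup_affine LM_meas moment2 s K) pK eK pK' eK').
- move=> x; exists (fun t w => Gamma (FE K) *m closed_loop Lam x (Gamma (FE K)) t w).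
  have [au le] := feedback_cost LamN_iid LM_meas LM_copy M_psd moment2 NP x pK eK.
  split=> // [t w|]; first by rewrite state_closed_loop.
  (* [feedback_cost] gives one inequality; admissibility gives the other, as [V x] is an infimum. *)
  apply/eqP; rewrite eq_le; apply/andP; split; first by rewrite (val_of K hK).
  by apply: ereal_inf_lbound; eexists; first exact: au.
- by rewrite -eK.
Qed.
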